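(* Fix $\alpha \in (0,1)\setminus \mathbf{Q}$ and let $(G(T))_{T\in\mathbf{N}}$ and $G(\infty)$ be generated by the evolving Shelah–Spencer process with parameter $\alpha$. Suppose $H/R$ is a safe finite graph extension and $t \geq 1$. Then almost surely the following holds: for every set $\bar R$ of vertices of $G(\infty)$ with $|\mathcal{V}(\bar R)| = |\mathcal{V}(R)|$, for all sufficiently large $T \leq \infty$ there exists a copy $\bar H/\bar R$ of $H/R$ in $G(T)$ that is $t$-generic in $G(T)$.
   Context: Evolving Shelah–Spencer process with parameter $\alpha>0$: start with a graph $G(1)$ consisting of a single node $u_1$. At each time $\tau \geq 2$, form $G(\tau)$ by adding a new node $u_\tau$ to $G(\tau-1)$ and joining $u_\tau$ to each earlier node $u_j$ ($j<\tau$) independently with probability $\tau^{-\alpha}$. $G(\infty)=\bigcup_\tau G(\tau)$. For finite graphs $A,B$ (abstract, taken disjoint, or subgraphs of a common ambient graph with $AB$ the induced subgraph on the union of the vertex sets), $\mathcal{V}(B/A)$ is the number of vertices of $AB$ not in $A$, $\mathcal{E}(B/A)$ the number of edges of $AB$ not having both endpoints in $A$, and $\delta(B/A)=\mathcal{V}(B/A)-\alpha\,\mathcal{E}(B/A)$. $B/A$ is safe if $\delta(I/A)\ge 0$ for all $A\subseteq I\subseteq AB$, and rigid if $\delta(B/I)\le 0$ for all $A\subseteq I\subsetneq AB$. A copy of $H/R$ over $\bar R$ is a set $\bar H$ of vertices together with a bijection $v(RH)\to v(\bar R\bar H)$ mapping $v(R)$ onto $v(\bar R)$ such that for vertices not both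 in $R$, adjacency is preserved in both directions (edges inside $R$, $\bar R$ are ignored). For subgraphs $A,B$ of an ambient graph $G$ and $t\in\mathbf{N}$, the extension $B/A$ is $t$-generic (in $G$) if whenever $C\subseteq G$ with $\mathcal{V}(C/AB)\le t$ and $C/AB$ rigid, then $\mathcal{E}(C/AB)=\mathcal{E}(C/A)$ (i.e. there are no edges between $C\setminus AB$ and $B\setminus A$). *)

(* Defs.v *)
From HB Require Import structures.
From mathcomp Require Import all_boot all_order all_algebra.
From mathcomp Require Import finmap.
From mathcomp Require Import all_classical all_reals all_analysis.

Set Implicit Arguments.
Unset Strict Implicit.
Unset Printing Implicit Defensive.

Import Order.TTheory GRing.Theory Num.Theory.
Local Open Scope ring_scope.

Record sgraph (V : Type) := SGraph {
  adj :> rel V;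
  adj_sym : symmetric adj;
  adj_irrefl : irreflexive adj }.

(* Finite subgraphs of an ambient graph are given by their vertex sets: every
   notion below depends only on the vertex sets A, B and on the adjacencies of
   the induced subgraph AB on their union. *)
Section Extensions.
Context {V : choiceType} (G : sgraph V).
Implicit Types (A B C I : {fset V}) (U : pred V).

Definition edges A : {fset {fset V}} :=
  [fset [fset x; y]%fset | x in A, y in A & G x y]%fset.

(* \mathcal{V}(B/A) and \mathcal{E}(B/A); the extended graph comes first. *)
Definition nv B A : nat := #|` ((A `|` B) `\` A)%fset|.
Definition ne B A : nat :=
  #|` [fset s in edges (A `|` B) | ~~ (s `<=` A)]%fset|.

Definition delta {K : realType} (alpha : K) B A : K :=
  (nv B A)%:R - alpha * (ne B A)%:R.

Definition safe {K : realType} (alpha : K) B A : Prop :=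
  forall I, (A `<=` I)%fset -> (I `<=` A `|` B)%fset -> 0 <= delta alpha I A.

Definition rigid {K : realType} (alpha : K) B A : Prop :=
  forall I, (A `<=` I)%fset -> (I `<` A `|` B)%fset -> delta alpha B I <= 0.

(* B/A is t-generic in the subgraph of G induced on U.  C must avoid B \ A:
   otherwise E(C/A) would also count edges of AB, and the equality would not
   say that there are no edges between C \ AB and B \ A.  The extension C/AB
   only depends on C \ AB, so this excludes no extension. *)
Definition generic {K : realType} (alpha : K) (t : nat) U B A : Prop :=
  forall C, {subset C <= U} -> [disjoint C & B `\` A]%fset ->
    (nv C (A `|` B)%fset <= t)%N -> rigid alpha C (A `|` B)%fset ->
    ne C (A `|` B)%fset = ne C A.

End Extensions.

(* The set H' is a copy of H/R over R' (H, R in the graph F; H', R' in G).  The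
   values of f outside R `|` H are irrelevant. *)
Definition is_copy {V W : choiceType} (F : sgraph V) (G : sgraph W)
    (H R : {fset V}) (H' R' : {fset W}) : Prop :=
  exists f : V -> W,
    [/\ {in (R `|` H)%fset &, injective f},
        (f @` (R `|` H))%fset = (R' `|` H')%fset,
        (f @` R)%fset = R' &
        forall x y, x \in (R `|` H)%fset -> y \in (R `|` H)%fset ->
          ~~ ((x \in R) && (y \in R)) -> F x y = G (f x) (f y)].

Section Process.
Context {d : measure_display} {T : measurableType d} {K : realType}.
Variable P : probability T K.

Definition independent_events {I : choiceType} (D : set I) (E : I -> set T) :
    Prop :=
  forall J : {fset I}, (forall i, i \in J -> D i) ->
    P (\bigcap_(i in [set` J]) E i)%classic = (\prod_(i <- J) P (E i))%E.

(* The vertex i : nat is the node u_(i+1), so that for i < j the pair {i, j} is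
   decided at time j + 1, when u_(j+1) is added.  The random graph G is
   G(infinity); see [nodes] for G(tau). *)
Record shelah_spencer (alpha : K) (G : T -> sgraph nat) : Prop := ShelahSpencer {
  ss_measurable : forall i j : nat, (i < j)%N ->
    measurable [set w | G w i j]%classic;
  ss_probability : forall i j : nat, (i < j)%N ->
    P [set w | G w i j]%classic = (j.+1%:R `^ (- alpha))%:E;
  ss_independent : independent_events
    [set p : nat * nat | (p.1 < p.2)%N]%classic
    (fun p => [set w | G w p.1 p.2]%classic) }.

End Process.

(* Times tau <= infinity: [Some n] is the finite time n and [None] is infinity.
   G(tau) is the subgraph of G(infinity) induced on [nodes tau], since at each
   time the only new edges are incident to the new node. *)
Definition time := option nat.

Definition time_ge (n0 : nat) (tau : time) : bool :=
  if tau is Some n then (n0 <= n)%N else true.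

Definition nodes (tau : time) : pred nat :=
  fun i => if tau is Some n then (i < n)%N else true.

(* Main.v *)
Require Import Defs.
From HB Require Import structures.
From mathcomp Require Import all_boot all_order all_algebra.
From mathcomp Require Import finmap.
From mathcomp Require Import all_classical all_reals all_analysis.
From mathcomp Require Import measurable_realfun.
From mathcomp Require Import zify ring lra.

Set Implicit Arguments.
Unset Strict Implicit.
Unset Printing Implicit Defensive.

Import Order.TTheory GRing.Theory Num.Theory.
Local Open Scope ring_scope.

(** It is enough to find one copy of H/R over R' that is generic in G(infinity),
    and the probability that there is none must be shown to vanish for each of
    the countably many R'.  Place the vertices of H \ R in disjoint blocks of
    length N = 2^n.  The number of placements realizing all edges of H/R
    concentrates around its mean mu: two placements agreeing on J contribute a
    relative covariance of order N^(-delta(J/R)), and delta(J/R) is bounded away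
    from 0 by safety and irrationality of alpha.

    A placement is spoiled by an extra edge, or by a rigid extension C whose
    edge set D meets the new vertices.  Let l(c) be the dyadic scale of c and
    gamma > 0 a lower bound for |u - alpha e| over 0 < u <= t.  Counting edges
    and vertices of scale at least k for every k, rigidity gives
      alpha * sum_(s in D) l(max s) >=
        (gamma/2) n + (1 + gamma/(2t)) * sum_(c in C) l(c),
    so each C costs at most 2^(-gamma n/2) times a product of weights that is
    summable over all C in nat.  Hence the mean number of spoiled placements is
    o(mu), uniformly in the truncation C < M, and a second moment bound leaves
    an unspoiled placement with probability tending to 1. *)

(** * The probabilistic sieve *)

Section Means.
Context {d : measure_display} {Omega : measurableType d} {K : realType}.
Variable P : probability Omega K.
Local Open Scope classical_set_scope.

(** Nonnegativity and measurability are bundled with a real-valued mean, so that expectations of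
    finite sums can be computed and compared in [K] rather than in the extended reals. *)
Definition has_mean (g : Omega -> K) (e : K) : Prop :=
  [/\ forall w, 0 <= g w, measurable_fun setT g & (\int[P]_w (g w)%:E = e%:E)%E].

Lemma has_mean_indic (S : set Omega) : measurable S ->
  has_mean (\1_S) (fine (P S)).
Proof.
move=> mS; split => [w||]; first by rewrite indicE.
  exact: measurable_indic.
by rewrite integral_indic// setIT fineK// fin_num_measure.
Qed.

Lemma has_mean_cst (c : K) : 0 <= c -> has_mean (fun=> c) c.
Proof.
move=> c0; split => //.
by rewrite integral_cst// [X in (_ * X)%E]probability_setT mule1.
Qed.

Lemma has_meanD (g1 g2 : Omega -> K) (e1 e2 : K) :
  has_mean g1 e1 -> has_mean g2 e2 -> has_mean (fun w => g1 w + g2 w) (e1 + e2).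
Proof.
move=> [g1_ge0 mg1 ig1] [g2_ge0 mg2 ig2]; split => [w||].
- exact: addr_ge0.
- exact: measurable_funD.
under eq_integral do rewrite EFinD.
rewrite ge0_integralD// ?ig1 ?ig2 ?EFinD// => [w _|||].
- by rewrite lee_fin.
- exact/measurable_EFinP.
- by move=> w _; rewrite lee_fin.
- exact/measurable_EFinP.
Qed.

Lemma has_meanZ (c : K) (g : Omega -> K) (e : K) :
  0 <= c -> has_mean g e -> has_mean (fun w => c * g w) (c * e).
Proof.
move=> c_ge0 [g_ge0 mg ig]; split => [w||].
- exact: mulr_ge0.
- exact: measurable_funM.
under eq_integral do rewrite EFinM.
rewrite ge0_integralZl_EFin// ?ig ?EFinM// => [w _|].
- by rewrite lee_fin.
- exact/measurable_EFinP.
Qed.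

Lemma has_mean_sum (I : Type) (s : seq I) (g : I -> Omega -> K) (e : I -> K) :
  (forall i, has_mean (g i) (e i)) ->
  has_mean (fun w => \sum_(i <- s) g i w) (\sum_(i <- s) e i).
Proof.
move=> ge; elim: s => [|i s IH].
  rewrite big_nil; under eq_fun do rewrite big_nil.
  exact: has_mean_cst.
by rewrite big_cons; under eq_fun do rewrite big_cons; exact: has_meanD.
Qed.

Lemma le_has_mean (g1 g2 : Omega -> K) (e1 e2 : K) :
  has_mean g1 e1 -> has_mean g2 e2 -> (forall w, g1 w <= g2 w) -> e1 <= e2.
Proof.
move=> [g1_ge0 mg1 ig1] [g2_ge0 mg2 ig2] le12.
rewrite -lee_fin -ig1 -ig2; apply: ge0_le_integral => // [w _|||].
- by rewrite lee_fin.
- exact/measurable_EFinP.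
- exact/measurable_EFinP.
- by move=> w _; rewrite lee_fin.
Qed.

(* With X the number of events E i that hold, Y the number of pairs
   (i, j) with E i and B j both holding, and mu the mean of X, one has
   X <= Y on A, whence mu^2 1_A + 2 mu X <= X^2 + mu^2 + 2 mu Y. *)
Lemma second_moment_sieve (I : finType) (J : eqType) (E : I -> set Omega)
    (B : J -> set Omega) (r : I -> seq J) (A : set Omega) :
    (forall i, measurable (E i)) -> (forall j, measurable (B j)) ->
    measurable A ->
    (forall w i, A w -> E i w -> exists2 j, j \in r i & B j w) ->
  let mu := \sum_i fine (P (E i)) in
  mu ^+ 2 * fine (P A) + mu ^+ 2 <=
    \sum_i \sum_k fine (P (E i `&` E k)) +
    2 * mu * \sum_i \sum_(j <- r i) fine (P (E i `&` B j)).
Proof.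
move=> mE mB mA hA; cbv zeta; set mu := \sum_i fine (P (E i)).
have mu_ge0 : 0 <= mu by apply: sumr_ge0 => i _; apply: fine_ge0; exact: measure_ge0.
rewrite -(lerD2r (mu ^+ 2)).
pose X w : K := \sum_i \1_(E i) w.
pose Y w : K := \sum_i \sum_(j <- r i) \1_(E i `&` B j) w.
have hL : has_mean (fun w => mu ^+ 2 * \1_A w + 2 * mu * X w)
   (mu ^+ 2 * fine (P A) + 2 * mu * mu).
  apply: has_meanD; apply: has_meanZ; rewrite ?sqr_ge0 ?mulr_ge0//.
    exact: has_mean_indic.
  by apply: has_mean_sum => i; exact: has_mean_indic.
have hR : has_mean (fun w => (\sum_i \sum_k \1_(E i `&` E k) w + 2 * mu * Y w)
    + mu ^+ 2)
   ((\sum_i \sum_k fine (P (E i `&` E k)) +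
    2 * mu * \sum_i \sum_(j <- r i) fine (P (E i `&` B j))) + mu ^+ 2).
  apply: has_meanD; last exact/has_mean_cst/sqr_ge0.
  apply: has_meanD; [|apply: has_meanZ; rewrite ?mulr_ge0//].
    do 2![apply: has_mean_sum => ?]; apply: has_mean_indic; exact: measurableI.
  do 2![apply: has_mean_sum => ?]; apply: has_mean_indic; exact: measurableI.
have -> : mu ^+ 2 * fine (P A) + mu ^+ 2 + mu ^+ 2 =
  mu ^+ 2 * fine (P A) + 2 * mu * mu by ring.
apply: (le_has_mean hL hR) => w.
have XX : \sum_i \sum_k \1_(E i `&` E k) w = X w ^+ 2.
  rewrite expr2 /X mulr_suml; apply: eq_bigr => i _; rewrite mulr_sumr.
  by apply: eq_bigr => k _; rewrite indicI.
rewrite XX.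
have Y_ge0 : 0 <= Y w by do 2![apply: sumr_ge0 => ? _]; rewrite indicE.
(* Off [A] the inequality is (X - mu)^2 >= 0 together with Y >= 0; on [A] it follows from X <= Y and
   X^2 >= 0. *)
have [Aw|nAw] := pselect (A w); last first.
  rewrite indicE memNset// mulr0 add0r.
  have : 0 <= 2 * mu * Y w by rewrite !mulr_ge0.
  by have := sqr_ge0 (X w - mu); nra.
have XY : X w <= Y w.
  apply: ler_sum => i _; rewrite indicE.
  have [Eiw|nEiw] := pselect (E i w); last first.
    by rewrite memNset//; apply: sumr_ge0 => ? _; rewrite indicE.
  rewrite mem_set//; have [j jr Bj] := hA _ _ Aw Eiw.
  rewrite (big_rem j)//= indicE mem_set//= lerDl.
  by apply: sumr_ge0 => ? _; rewrite indicE.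
rewrite indicE mem_set// mulr1.
have : 2 * mu * X w <= 2 * mu * Y w by rewrite ler_wpM2l ?mulr_ge0.
by have := sqr_ge0 (X w); nra.
Qed.

End Means.

(** * Edges and cylinder events *)

Lemma fset2_inj (V : choiceType) (x y a b : V) :
  [fset x; y]%fset = [fset a; b]%fset -> x = a /\ y = b \/ x = b /\ y = a.
Proof.
move=> /fsetP eq2; have := eq2 x; have := eq2 y.
rewrite !inE !eqxx !orbT /= => /esym/orP yab /esym/orP[] /eqP xE; subst x.
  case: yab => /eqP yE; subst y; last by left.
  by have := eq2 b; rewrite !inE eqxx !orbT orbb => /eqP ->; left.
case: yab => /eqP yE; subst y; first by right.
by have := eq2 a; rewrite !inE eqxx /= orbb => /eqP ->; left.
Qed.

Section Edges.
Context {V : choiceType} (G : sgraph V).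
Implicit Types (A Z s : {fset V}).

Lemma edgesP A s :
  reflect (exists x y, [/\ x \in A, y \in A, G x y & s = [fset x; y]%fset])
          (s \in edges G A).
Proof.
apply: (iffP (imfset2P _ _ _ _ _)) => [[x /= xA [y]]|[x [y [xA yA Gxy ->]]]].
  by rewrite !inE => /andP[yA Gxy] ->; exists x, y.
by exists x => //; exists y; rewrite // !inE yA.
Qed.

Lemma mem_edges2 x y A :
  ([fset x; y]%fset \in edges G A) = [&& x \in A, y \in A & G x y].
Proof.
apply/edgesP/and3P => [[a [b [aA bA Gab /fset2_inj]]]|[xA yA Gxy]].
  by case=> -[-> ->]; split => //; rewrite adj_sym.
by exists x, y.
Qed.

(** Being an edge is intrinsic to the pair [s]; the form [s \in edges G s] is used below to speak of
    an edge without an ambient vertex set. *)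
Lemma mem_edges A s : (s \in edges G A) = (s `<=` A)%fset && (s \in edges G s).
Proof.
apply/idP/andP => [/edgesP[x [y [xA yA Gxy ->]]]|[sA /edgesP[x [y [xs ys Gxy sE]]]]].
  split; first by apply/fsubsetP => z /fset2P[] ->.
  by rewrite mem_edges2 !inE !eqxx orbT.
by rewrite sE mem_edges2 (fsubsetP sA _ xs) (fsubsetP sA _ ys).
Qed.

Lemma card_edge A s : s \in edges G A -> #|` s| = 2.
Proof.
move=> /edgesP[x [y [_ _ Gxy ->]]]; rewrite cardfs2.
by case: eqVneq Gxy => // ->; rewrite adj_irrefl.
Qed.

End Edges.

Definition pairs {V : choiceType} (Z : {fset V}) : {fset {fset V}} :=
  [fset s in fpowerset Z | #|` s| == 2]%fset.

Lemma mem_pairs (V : choiceType) (Z s : {fset V}) :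
  (s \in pairs Z) = (s `<=` Z)%fset && (#|` s| == 2).
Proof. by rewrite !inE fpowersetE. Qed.

Lemma card_pairs (V : choiceType) (Z : {fset V}) :
  (#|` pairs Z| <= 2 ^ #|` Z|)%N.
Proof.
rewrite -card_fpowerset; apply: fsubset_leq_card; apply/fsubsetP => s.
by rewrite !inE => /andP[].
Qed.

Lemma edges_pairs (V : choiceType) (G : sgraph V) (A : {fset V}) :
  (edges G A `<=` pairs A)%fset.
Proof.
apply/fsubsetP => s sG; rewrite mem_pairs (card_edge sG) eqxx andbT.
by move: sG; rewrite mem_edges => /andP[].
Qed.

Definition top (s : {fset nat}) : nat := \max_(x <- s) x.

Lemma leq_top (s : {fset nat}) (x : nat) : x \in s -> (x <= top s)%N.
Proof. by move=> xs; rewrite /top (big_rem x) //= leq_maxl. Qed.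

Lemma top_leq (s : {fset nat}) (b : nat) :
  (forall x, x \in s -> x <= b)%N -> (top s <= b)%N.
Proof. by move=> sb; rewrite /top big_seq; apply/bigmax_leqP_seq => x xs _; exact: sb. Qed.

Lemma top2 i j : (i < j)%N -> top [fset i; j]%fset = j.
Proof.
move=> ij; apply/eqP; rewrite eqn_leq leq_top ?inE ?eqxx ?orbT// andbT.
by apply: top_leq => x /fset2P[] -> //; exact: ltnW.
Qed.

(** For a pair, removing the larger element from the sum leaves the smaller one; only pairs
    matter. *)
Definition bottom (s : {fset nat}) : nat := (\sum_(x <- s) x - top s)%N.

Lemma bottom2 i j : (i < j)%N -> bottom [fset i; j]%fset = i.
Proof.
move=> ij; rewrite /bottom top2// big_fsetU1 ?inE ?neq_ltn ?ij//=.
by rewrite big_seq_fset1 addnK.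
Qed.

Lemma card2_fset2 (s : {fset nat}) : #|` s| = 2 ->
  (bottom s < top s)%N /\ s = [fset bottom s; top s]%fset.
Proof.
move=> s2; have [i [j [ij ->]]] : exists i j, (i < j)%N /\ s = [fset i; j]%fset.
  have : (0 < #|` s|)%N by rewrite s2.
  rewrite cardfs_gt0 => /fset0Pn[a aS].
  have := cardfsD1 a s; rewrite aS s2 => -[] /esym/eqP/cardfs1P[b sE].
  have ba : b != a.
    by have := fset11 b; rewrite -sE !inE => /andP[].
  have {sE}-> : s = [fset a; b]%fset by rewrite -sE fsetD1K.
  move: ba; rewrite neq_ltn => /orP[] h; [exists b, a|exists a, b] => //.
  by split => //; rewrite fsetUC.
by rewrite top2 ?bottom2.
Qed.

Section Cylinders.
Context {d : measure_display} {Omega : measurableType d} {K : realType}.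
Variable (P : probability Omega K) (alpha : K) (G : Omega -> sgraph nat).
Hypothesis G_process : shelah_spencer P alpha G.
Implicit Types (D S : {fset {fset nat}}).
Local Open Scope classical_set_scope.

(** The event is empty as soon as [D] has an element that is not a pair, since edges have two
    elements. *)
Definition cylinder (H : Omega -> sgraph nat) D : set Omega :=
  [set w | forall s, s \in D -> s \in edges (H w) s].

Lemma cylinderU D S : cylinder G (D `|` S)%fset = cylinder G D `&` cylinder G S.
Proof.
apply/seteqP; split => w /=.
  by move=> h; split => s sD; apply: h; rewrite inE sD ?orbT.
by move=> [hD hS] s; rewrite inE => /orP[/hD|/hS].
Qed.

Lemma edge_event (s : {fset nat}) : #|` s| = 2 ->
  [set w | s \in edges (G w) s] = [set w | G w (bottom s) (top s)].
Proof.
move=> /card2_fset2[bt sE]; apply/seteqP; split => w /=.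
  by rewrite {1}sE mem_edges2 => /and3P[].
by rewrite {3}sE mem_edges2 sE top2 ?bottom2// !inE !eqxx orbT.
Qed.

Lemma measurable_cylinder D : measurable (cylinder G D).
Proof.
have -> : cylinder G D = \bigcap_(s in [set` D]) [set w | s \in edges (G w) s].
  by apply/seteqP; split.
apply: fin_bigcap_measurable => // s _.
have [s2|s2] := eqVneq #|` s| 2%N.
  by rewrite edge_event//; apply: (ss_measurable G_process); case: (card2_fset2 s2).
rewrite (_ : [set _ | _] = set0)//; apply/seteqP; split => // w /= /card_edge.
by move/eqP; rewrite (negbTE s2).
Qed.

(** The pair is decided when its later endpoint [top s] arrives, at time [(top s).+1]. *)
Definition edge_prob (s : {fset nat}) : K := (top s).+1%:R `^ (- alpha).

Lemma edge_prob_ge0 s : 0 <= edge_prob s. Proof. exact: powR_ge0. Qed.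

Definition weight D : K := \prod_(s <- D) edge_prob s.

Lemma weight_ge0 D : 0 <= weight D.
Proof. by apply: prodr_ge0 => s _; exact: edge_prob_ge0. Qed.

Lemma probability_cylinder D : (forall s, s \in D -> #|` s| = 2) ->
  P (cylinder G D) = (weight D)%:E.
Proof.
(* Independence is stated for increasing pairs (i, j); [h] carries unordered pairs to them
   injectively. *)
move=> D2; pose h (s : {fset nat}) := (bottom s, top s).
have h_inj : {in D &, injective h}.
  move=> s s' sD s'D [hb ht].
  have [_ ->] := card2_fset2 (D2 _ sD); have [_ ->] := card2_fset2 (D2 _ s'D).
  by rewrite hb ht.
have -> : cylinder G D = \bigcap_(p in [set` (h @` D)%fset]) [set w | G w p.1 p.2].
  apply/seteqP; split => w /= hw.
    move=> p /= /imfsetP[s /= sD ->] /=; have := hw s sD.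
    by have /seteqP[+ _] := edge_event (D2 _ sD) => /(_ w); apply.
  move=> s sD; have /seteqP[_ +] := edge_event (D2 _ sD) => /(_ w); apply.
  by apply: (hw (h s)) => /=; exact: in_imfset.
rewrite (ss_independent G_process); last first.
  by move=> p /imfsetP[s /= sD ->] /=; case: (card2_fset2 (D2 _ sD)).
rewrite big_imfset//= -prodEFin big_seq [RHS]big_seq; apply: eq_bigr => s sD.
by rewrite (ss_probability G_process)//; case: (card2_fset2 (D2 _ sD)).
Qed.

Lemma weightU D S : [disjoint D & S]%fset ->
  weight (D `|` S)%fset = weight D * weight S.
Proof.
move=> /fdisjointP DS; rewrite /weight (big_fsetID _ (mem D))/=.
congr (_ * _); apply: eq_fbigl => s; rewrite !inE/=.
  by case: (boolP (s \in D)); rewrite ?andbF.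
by case: (boolP (s \in D)) => [/DS/negbTE ->|]; rewrite ?andbF ?andbT.
Qed.

End Cylinders.

(** * Scales and rigid extensions *)

Section Gap.
Context {K : realType}.
Variable alpha : K.
Hypotheses (alpha_gt0 : 0 < alpha) (alpha_irrational : irrational alpha).

Lemma subr_irrational_neq0 (v e : nat) : (0 < v)%N -> v%:R - alpha * e%:R != 0.
Proof.
move=> v0; apply/negP; rewrite subr_eq0 => /eqP vE.
have e0 : e%:R != 0 :> K.
  apply/eqP => e0; move: vE; rewrite e0 mulr0 => /eqP.
  by rewrite pnatr_eq0; case: v v0.
apply: alpha_irrational; exists (v%:R / e%:R) => //.
by rewrite fmorph_div !rmorph_nat vE mulfK.
Qed.

(** For fixed v, the distance |v - alpha e| exceeds 1 for all but finitely many e, and irrationality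
    excludes the value 0 for the remaining ones. *)
Lemma irrational_gap (t : nat) : exists2 gamma : K, 0 < gamma &
  forall v e : nat, (0 < v <= t)%N -> gamma <= `|v%:R - alpha * e%:R|.
Proof.
have gap_bounded v E : (0 < v)%N -> exists2 gamma : K, 0 < gamma &
    forall e : nat, (e < E)%N -> gamma <= `|v%:R - alpha * e%:R|.
  move=> v0; elim: E => [|E [g g0 gE]]; first by exists 1.
  exists (Num.min g `|v%:R - alpha * E%:R|).
    by rewrite lt_min g0 normr_gt0 subr_irrational_neq0.
  move=> e; rewrite ltnS leq_eqVlt => /orP[/eqP->|/gE h].
    by rewrite ge_min lexx orbT.
  by rewrite ge_min h.
have gap_all v : (0 < v)%N -> exists2 gamma : K, 0 < gamma &
    forall e : nat, gamma <= `|v%:R - alpha * e%:R|.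
  (* From [E] on, alpha e > v + 1. *)
  move=> v0; pose E := Num.bound ((v%:R + 1) / alpha).
  have [g g0 gE] := gap_bounded v E v0.
  exists (Num.min g 1); first by rewrite lt_min g0 ltr01.
  move=> e; have [/gE h|Ee] := ltnP e E; first by rewrite ge_min h.
  rewrite ge_min; apply/orP; right.
  have hE : (v%:R + 1) / alpha < e%:R.
    apply: lt_le_trans (archi_boundP _) _; last by rewrite ler_nat.
    by rewrite divr_ge0 ?ltW// addr_ge0.
  rewrite ltr_pdivrMr// in hE.
  by rewrite distrC ler_normr; apply/orP; left; lra.
elim: t => [|t [g g0 gt]]; first by exists 1 => // v e; case: v.
have [g' g'0 gt'] := gap_all t.+1 isT.
exists (Num.min g g'); first by rewrite lt_min g0.
move=> v e /andP[v0]; rewrite leq_eqVlt => /orP[/eqP->|vt].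
  by rewrite ge_min gt' orbT.
by rewrite ge_min gt// v0.
Qed.

End Gap.

(** Layer-cake summation: c is counted once at each level k from 1 to l(c). *)
Lemma sum_layers (T : choiceType) (C : {fset T}) (l : T -> nat) (L : nat) :
    (forall c, c \in C -> l c <= L)%N ->
  (\sum_(c <- C) l c =
   \sum_(1 <= k < L.+1) #|` [fset c in C | (k <= l c)%N]%fset|)%N.
Proof.
move=> CL.
under [RHS]eq_bigr do rewrite -sum1_size big_fset/= big_mkcond/=.
rewrite exchange_big/= big_seq [RHS]big_seq; apply: eq_bigr => c cC.
rewrite -big_mkcond/= (big_cat_nat _ (n := (l c).+1))//=; last exact: CL.
rewrite [X in (_ + X)%N]big1_seq ?addn0; last first.
  by move=> k /andP[kl]; rewrite mem_index_iota ltnNge kl.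
rewrite big_nat_cond (eq_bigl (fun k => 1 <= k < (l c).+1)%N); last first.
  by move=> k; rewrite ltnS; case: (k <= l c)%N; rewrite ?andbF ?andbT.
by rewrite -big_nat sum_nat_const_nat subn1 muln1.
Qed.

(** The shift makes scale l the block of all c with 2^l <= c + 1 < 2^(l+1), where c + 1 is the
    arrival time of c. *)
Definition scale (c : nat) : nat := trunc_log 2 c.+1.

Lemma leq_scale c c' : (c <= c')%N -> (scale c <= scale c')%N.
Proof. by move=> cc'; apply: leq_trunc_log; rewrite ltnS. Qed.

Lemma edge_prob_le_scale (K : realType) (alpha : K) (s : {fset nat}) :
  0 <= alpha -> edge_prob alpha s <= 2 `^ (- (alpha * (scale (top s))%:R)).
Proof.
move=> a0; rewrite /edge_prob mulrC -mulrN powRrM powR_mulrn// -natrX.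
have := @trunc_logP 2 (top s).+1 isT isT; rewrite -/(scale _) => le_top.
rewrite !powRN lef_pV2 ?posrE ?powR_gt0 ?ltr0n ?expn_gt0//.
by apply: ge0_ler_powR; rewrite ?nnegrE ?ler0n// ler_nat.
Qed.

(** A rigid extension of [Z] that violates genericity, described by a prospective edge set [D]
    instead of a graph: the last clause is rigidity with edges counted in [D], the fourth is the
    forbidden edge at [B]. *)
Definition bad_extension {K : realType} (alpha : K) (t : nat) (Z B C : {fset nat})
    (D : {fset {fset nat}}) : Prop :=
  [/\ (0 < #|` C| <= t)%N, [disjoint C & Z]%fset,
      (forall s, s \in D -> ~~ (s `<=` Z)%fset),
      (exists s b, [/\ s \in D, b \in s & b \in B]) &
      forall I, (Z `<=` I)%fset -> (I `<` Z `|` C)%fset ->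
        #|` ((Z `|` C) `\` I)%fset|%:R <=
          alpha * #|` [fset s in D | ~~ (s `<=` I)]%fset|%:R].

Section BadExtension.
Context {K : realType}.
Variables (alpha gamma : K) (t n : nat) (Z B C : {fset nat}) (D : {fset {fset nat}}).
Hypotheses (gamma_gt0 : 0 < gamma) (gamma_alpha : gamma <= alpha).
Hypothesis gap : forall v e : nat, (0 < v <= t)%N ->
  gamma <= `|v%:R - alpha * e%:R|.
Hypothesis scaleB : forall b, b \in B -> (n <= scale b)%N.
Hypothesis badD : bad_extension alpha t Z B C D.
Hypothesis DZC : forall s, s \in D -> (s `<=` Z `|` C)%fset.

(* At level k, rigidity over the vertices of scale less than k bounds the number
   of edges reaching level k from below; if C has no vertex at level k <= n,
   the edge between C and B does. *)
Lemma bad_extension_layer (k : nat) :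
  gamma / 2 * (k <= n)%N%:R + (1 + gamma / (2 * t%:R)) *
     #|` [fset c in C | (k <= scale c)%N]%fset|%:R <=
  alpha * #|` [fset s in D | (k <= scale (top s))%N]%fset|%:R.
Proof.
have [/andP[C0 Ct] /fdisjointP CZ DnZ [s0 [b [s0D bs0 bB]]] rigidC] := badD.
set Ck := [fset c in C | _]%fset; set Dk := [fset s in D | _]%fset.
have a0 : 0 < alpha by apply: lt_le_trans gamma_alpha.
have t0 : 0 < t%:R :> K by rewrite ltr0n (leq_trans C0).
have [Ck0|Ck_neq0] := eqVneq Ck fset0.
  rewrite Ck0 cardfs0 mulr0 addr0.
  have [kn|nk] := leqP k n; last by rewrite mulr0 mulr_ge0// ltW.
  have : (0 < #|` Dk|)%N.
    rewrite cardfs_gt0; apply/fset0Pn; exists s0; rewrite !inE s0D/=.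
    apply: (leq_trans kn); apply: (leq_trans (scaleB bB)).
    exact/leq_scale/leq_top.
  rewrite -(ler_nat K) => h.
  have := ler_wpM2l (ltW a0) h; rewrite !mulr1; move: gamma_gt0 gamma_alpha; lra.
(* An edge of [D] not inside this [I] contains a vertex of [C] of scale at least k, so its larger
   endpoint has scale at least k too. *)
pose I := (Z `|` [fset c in C | (scale c < k)%N])%fset.
have ICk : ((Z `|` C) `\` I)%fset = Ck.
  apply/fsetP => c; rewrite !inE.
  case: (boolP (c \in C)) => [/CZ/negbTE ->|_] /=; last by rewrite !orbF andbC andbN.
  by rewrite ?orbF andbT -leqNgt.
have IZC : (I `<` Z `|` C)%fset.
  rewrite fproperEneq; apply/andP; split.
    by apply: contra Ck_neq0 => /eqP II; rewrite -ICk II fsetDv.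
  by apply/fsubsetP => c; rewrite !inE => /orP[->//|/andP[->]]; rewrite orbT.
have := rigidC _ (fsubsetUl _ _) IZC; rewrite ICk.
set e := #|` [fset s in D | _]%fset| => le_e.
have e_le : (e <= #|` Dk|)%N.
  apply: fsubset_leq_card; apply/fsubsetP => s; rewrite !inE => /andP[sD /fsubsetPn].
  rewrite sD /= => -[c cs cI].
  have kc : (k <= scale c)%N.
    move: cI (fsubsetP (DZC sD) _ cs); rewrite !inE negb_or => /andP[/negbTE ->] /=.
    by move=> + cC; rewrite cC/= -leqNgt.
  by apply: (leq_trans kc); exact/leq_scale/leq_top.
have c0 : (0 < #|` Ck| <= t)%N.
  rewrite cardfs_gt0 Ck_neq0 (leq_trans _ Ct)//.
  by apply: fsubset_leq_card; apply/fsubsetP => c; rewrite !inE => /andP[].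
(* The gap improves |Ck| <= alpha e to |Ck| + gamma <= alpha e. One half of gamma pays for the term
   in n, the other for gamma/(2t) |Ck|, because |Ck| <= t. *)
have := gap e c0; rewrite distrC ger0_norm ?subr_ge0// => gap_e.
have : (#|` Ck|)%:R <= t%:R :> K by rewrite ler_nat; case/andP: c0.
move/(ler_wpM2l (ltW (divr_gt0 gamma_gt0 t0))); rewrite divfK ?gt_eqF// => gt.
have : alpha * e%:R <= alpha * (#|` Dk|)%:R by rewrite ler_pM2l// ler_nat.
have -> : gamma / (2 * t%:R) = gamma / t%:R / 2 by field; rewrite gt_eqF.
have : gamma / 2 * (k <= n)%N%:R <= gamma / 2.
  by move: gamma_gt0; case: (k <= n)%N; rewrite ?mulr1 ?mulr0; lra.
by rewrite mulrDl mul1r; move: gap_e gt; set x := gamma / t%:R; set y := alpha * e%:R; nra.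
Qed.

Lemma bad_extension_scale :
  gamma / 2 * n%:R + (1 + gamma / (2 * t%:R)) * (\sum_(c <- C) scale c)%N%:R <=
  alpha * (\sum_(s <- D) scale (top s))%N%:R.
Proof.
(* A common bound for n and all scales involved, so that the three quantities are layer sums over
   the same range and compare level by level. *)
pose L := (n + \sum_(c <- C) scale c + \sum_(s <- D) scale (top s))%N.
have nE : n = (\sum_(1 <= k < L.+1) (k <= n)%N)%N.
  have := @sum_layers nat [fset 0%N]%fset (fun=> n) L; rewrite big_seq_fset1 => nL; rewrite {1}nL.
    apply: eq_bigr => k _; case: (leqP k n) => kn.
      rewrite (_ : [fset _ in _ | _]%fset = [fset 0%N]%fset) ?cardfs1//.
      by apply/fsetP => x; rewrite !inE andbT.
    rewrite (_ : [fset _ in _ | _]%fset = fset0) ?cardfs0//.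
    by apply/fsetP => x; rewrite !inE andbF.
  by move=> _ _; rewrite /L -addnA leq_addr.
rewrite {1}nE (@sum_layers _ C scale L); last first.
  move=> c cC; rewrite /L addnAC (leq_trans _ (leq_addl _ _))//.
  by rewrite (big_rem c)//= leq_addr.
rewrite (@sum_layers _ D _ L); last first.
  by move=> s sD; rewrite (leq_trans _ (leq_addl _ _))// (big_rem s)//= leq_addr.
rewrite !natr_sum !mulr_sumr -big_split/=; apply: ler_sum => k _.
exact: bad_extension_layer.
Qed.

(** Each edge of [D] has probability at most 2^(-alpha l), l being the scale of its larger endpoint,
    so the linear inequality between scales exponentiates. *)
Lemma weight_bad_extension :
  weight alpha D <= 2 `^ (- (gamma / 2 * n%:R)) *
    \prod_(c <- C) (2 `^ (- (1 + gamma / (2 * t%:R)))) ^+ scale c.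
Proof.
have prod2 (T : choiceType) (A : {fset T}) (l : T -> nat) (u : K) :
    \prod_(x <- A) 2 `^ (u * (l x)%:R) = 2 `^ (u * (\sum_(x <- A) l x)%N%:R).
  elim/big_rec2 : _ => [|x y z _ ->]; first by rewrite mulr0 powRr0.
  by rewrite natrD mulrDr powRD// implybE pnatr_eq0 orbT.
have -> : \prod_(c <- C) (2 `^ (- (1 + gamma / (2 * t%:R)))) ^+ scale c =
  2 `^ (- (1 + gamma / (2 * t%:R)) * (\sum_(c <- C) scale c)%N%:R).
  by rewrite -prod2; apply: eq_bigr => c _; rewrite powRrM powR_mulrn// powR_ge0.
rewrite -powRD ?implybE ?pnatr_eq0 ?orbT//.
apply: (@le_trans _ _ (\prod_(s <- D) 2 `^ (- alpha * (scale (top s))%:R))).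
  apply: ler_prod => s _; rewrite edge_prob_ge0/= mulNr.
  exact/edge_prob_le_scale/ltW/(lt_le_trans gamma_gt0).
rewrite prod2; apply: ler_powR; first by rewrite ler1n.
have := bad_extension_scale; lra.
Qed.

End BadExtension.

(** * Sums over scales and over finite vertex sets *)

Section ScaleSums.
Context {K : realType}.

(** Exactly 2^l integers have scale l, so over complete blocks the sum is geometric with ratio
    2y. *)
Lemma sum_scale_le (y : K) (M : nat) : 0 <= y -> 2 * y < 1 ->
  \sum_(c < M) y ^+ scale c <= (1 - 2 * y)^-1.
Proof.
move=> y0 y1.
have dyadic L : \sum_(0 <= c < (2 ^ L).-1) y ^+ scale c = \sum_(l < L) (2 * y) ^+ l.
  elim: L => [|L IH]; first by rewrite big_ord0 big_geq.
  have le2 : ((2 ^ L).-1 <= (2 ^ L.+1).-1)%N.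
    by rewrite -!subn1 leq_sub2r// leq_exp2l.
  rewrite (big_cat_nat _ (n := (2 ^ L).-1))//= IH big_ord_recr/=; congr (_ + _).
  rewrite (eq_big_nat _ _ (F2 := fun=> y ^+ L)); last first.
    move=> c /andP[c1 c2]; congr (_ ^+ _); apply: trunc_log_eq => //.
    have : (0 < 2 ^ L)%N by rewrite expn_gt0.
    have : (0 < 2 ^ L.+1)%N by rewrite expn_gt0.
    lia.
  rewrite big_const_nat iter_addr_0.
  have -> : ((2 ^ L.+1).-1 - (2 ^ L).-1 = 2 ^ L)%N.
    have : (0 < 2 ^ L)%N by rewrite expn_gt0.
    rewrite expnS; lia.
  by rewrite -[LHS]mulr_natl exprMn natrX.
rewrite -(big_mkord xpredT (fun c => y ^+ scale c)).
apply: (@le_trans _ _ (\sum_(0 <= c < (2 ^ M.+1).-1) y ^+ scale c)).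
  have le2 : (M <= (2 ^ M.+1).-1)%N.
    have := ltn_expl M (isT : (1 < 2)%N); rewrite expnS; lia.
  rewrite [leRHS](big_cat_nat _ (n := M))//= lerDl.
  by apply: sumr_ge0 => c _; exact: exprn_ge0.
rewrite dyadic -[leRHS]mul1r ler_pdivlMr ?subr_gt0//.
have := subrX1 (2 * y) M.+1; have : 0 <= (2 * y) ^+ M.+1 by rewrite exprn_ge0 ?mulr_ge0.
by set S := \sum_(_ < _) _; nra.
Qed.

(** The left side expands the product of the factors 1 + w(i), and 1 + x <= exp x. *)
Lemma sum_subsets_le (I : finType) (w : I -> K) : (forall i, 0 <= w i) ->
  \sum_(C : {set I}) \prod_(c in C) w c <= expR (\sum_i w i).
Proof.
move=> w0; rewrite expR_sum.
apply: (@le_trans _ _ (\prod_i (w i + 1))); last first.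
  by apply: ler_prod => i _; rewrite addr_ge0//= addrC expR_ge1Dx.
rewrite bigA_distr/= le_eqVlt; apply/orP; left; apply/eqP.
apply: eq_big => [C|C _]; first by rewrite !inE.
rewrite [RHS](bigID (mem C))/= [X in _ = _ * X]big1.
  by rewrite mulr1; apply: eq_bigr => i ->.
by move=> i /negbTE ->.
Qed.

End ScaleSums.

(** * Structures that spoil a placement and their expected number *)

Definition fset_of_set (M : nat) (C : {set 'I_M}) : {fset nat} :=
  [fset val i | i in C]%fset.

Lemma mem_fset_of_set (M : nat) (C : {fset nat}) :
  (forall c, c \in C -> c < M)%N -> exists C' : {set 'I_M}, fset_of_set C' = C.
Proof.
move=> CM; exists [set i : 'I_M | val i \in C]; apply/fsetP => c.
apply/imfsetP/idP => [[i /= + ->]|cC]; first by rewrite inE.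
by exists (Ordinal (CM c cC)); rewrite //= inE.
Qed.

Section BadList.
Context {K : realType}.
Variables (alpha : K) (t : nat) (A B : {fset nat}) (S : {fset {fset nat}}).
Let Z := (A `|` B)%fset.

(** Here [A] is the image of R, [B] the set of new vertices and [S] the prescribed edges. Unwanted
    edges are wrapped as singletons, so that both kinds of spoiling structure are edge sets. *)
Definition extra_edges : seq {fset {fset nat}} :=
  [seq [fset s]%fset | s <- pairs Z & ~~ (s `<=` A)%fset && (s \notin S)].

Definition bad_extensions (C : {fset nat}) : seq {fset {fset nat}} :=
  [seq D <- fpowerset (pairs (Z `|` C)%fset) |
     `[< bad_extension alpha t Z B C D >]].

(** Truncating extensions to vertices below [M] keeps the list finite; [sum_bad_list] bounds its
    total weight uniformly in [M]. *)
Definition bad_list (M : nat) : seq {fset {fset nat}} :=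
  extra_edges ++ flatten [seq bad_extensions (fset_of_set C) | C : {set 'I_M}].

Lemma mem_bad_list M D :
  (D \in bad_list M) <->
  D \in extra_edges \/
  (exists2 C : {fset nat}, (forall c, c \in C -> (c < M)%N) &
     D \in bad_extensions C).
Proof.
rewrite mem_cat; split => [/orP[|/flatten_imageP[C _ DC]]|[->//|[C CM DC]]].
- by left.
- right; exists (fset_of_set C) => // c /imfsetP[i _ ->]; exact: ltn_ord.
- apply/orP; right; apply/flatten_imageP.
  by have [C' C'E] := mem_fset_of_set CM; exists C'; rewrite ?C'E.
Qed.

Lemma bad_list_mono M M' : (M <= M')%N -> {subset bad_list M <= bad_list M'}.
Proof.
move=> MM' D /mem_bad_list[DE|[C CM DC]]; apply/mem_bad_list; first by left.
by right; exists C => // c /CM cM; exact: leq_trans MM'.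
Qed.

(** Extra edges avoid [S] by definition, and edges of a bad extension leave [Z]. Disjointness makes
    the presence of [D] independent of that of [S]. *)
Lemma bad_list_disjoint M D : (S `<=` pairs Z)%fset -> D \in bad_list M ->
  [disjoint S & D]%fset.
Proof.
move=> SZ /mem_bad_list[/mapP[s]|[C _]].
  by rewrite mem_filter => /andP[/andP[_ sS] _] ->; rewrite fdisjointX1.
rewrite mem_filter => /andP[/asboolP[_ _ DZ _ _] _].
apply/fdisjointP => s /(fsubsetP SZ); rewrite mem_pairs => /andP[sZ _].
by apply/negP => /DZ; rewrite sZ.
Qed.

Lemma bad_list_card2 M D s : D \in bad_list M -> s \in D -> #|` s| = 2.
Proof.
move=> /mem_bad_list[/mapP[s']|[C _]].
  rewrite mem_filter mem_pairs => /andP[_ /andP[_ /eqP s'2]] ->.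
  by rewrite inE => /eqP ->.
rewrite mem_filter fpowersetE => /andP[_ /fsubsetP DC] /DC.
by rewrite mem_pairs => /andP[_ /eqP].
Qed.

Section FirstMoment.
Variables (gamma : K) (n : nat).
Hypotheses (gamma_gt0 : 0 < gamma) (gamma_alpha : gamma <= alpha).
Hypothesis gap : forall v e : nat, (0 < v <= t)%N ->
  gamma <= `|v%:R - alpha * e%:R|.
Hypothesis t_gt0 : (0 < t)%N.
Hypothesis scaleB : forall b, b \in B -> (n <= scale b)%N.

Let y : K := 2 `^ (- (1 + gamma / (2 * t%:R))).

(** An extra edge leaves [A], hence has an endpoint in [B], of scale at least n; its probability is
    at most 2^(-alpha n), and gamma/2 <= alpha. *)
Lemma sum_extra_edges : \sum_(D <- extra_edges) weight alpha D <=
  (2 ^ #|` Z|)%N%:R * 2 `^ (- (gamma / 2 * n%:R)).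
Proof.
have a0 : 0 <= alpha by exact/ltW/(lt_le_trans gamma_gt0).
rewrite big_map big_filter.
apply: (@le_trans _ _ (\sum_(s <- pairs Z) 2 `^ (- (gamma / 2 * n%:R)))).
  rewrite big_seq_cond [leRHS]big_seq.
  apply: (@le_trans _ _ (\sum_(s <- pairs Z | (s \in pairs Z) &&
      (~~ (s `<=` A)%fset && (s \notin S))) 2 `^ (- (gamma / 2 * n%:R)))); last first.
    rewrite big_mkcondr/=; apply: ler_sum => s _; case: ifP => _; by rewrite ?lexx ?powR_ge0.
  apply: ler_sum => s /andP[]; rewrite mem_pairs => /andP[sZ _].
  move=> /andP[/fsubsetPn[b bs bA] _]; rewrite /weight big_seq_fset1.
  apply: le_trans (edge_prob_le_scale _ a0) _.
  apply: ler_powR; rewrite ?ler1n// lerN2.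
  have nb : (n <= scale (top s))%N.
    apply: (leq_trans (scaleB _)); last exact/leq_scale/(leq_top bs).
    by have := fsubsetP sZ _ bs; rewrite inE (negbTE bA).
  apply: ler_pM; rewrite ?ler0n ?ler_nat// ?divr_ge0 ?ltW//.
  by move: gamma_gt0 gamma_alpha; lra.
rewrite big_const_seq count_predT iter_addr_0 -[leLHS]mulr_natl ler_wpM2r ?powR_ge0//.
by rewrite ler_nat card_pairs.
Qed.

Lemma sum_bad_extensions (C : {fset nat}) :
  \sum_(D <- bad_extensions C) weight alpha D <=
  (2 ^ 2 ^ (#|` Z| + t))%N%:R * 2 `^ (- (gamma / 2 * n%:R)) *
    \prod_(c <- C) y ^+ scale c.
Proof.
set b := _ * \prod_(c <- C) _.
have y0 : 0 <= \prod_(c <- C) y ^+ scale c.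
  by apply: prodr_ge0 => c _; rewrite exprn_ge0// powR_ge0.
(* With more than t vertices in [C] the list is empty; otherwise at most 2^2^(|Z|+t) edge sets are
   available. *)
have [Ct|tC] := leqP #|` C| t; last first.
  rewrite /bad_extensions big_filter big1; first by rewrite /b !mulr_ge0 ?powR_ge0.
  by move=> D /asboolP[/andP[_]]; rewrite leqNgt tC.
rewrite /bad_extensions big_filter.
apply: (@le_trans _ _ (\sum_(D <- fpowerset (pairs (Z `|` C)%fset))
   2 `^ (- (gamma / 2 * n%:R)) * \prod_(c <- C) y ^+ scale c)).
  rewrite big_mkcond big_seq [leRHS]big_seq; apply: ler_sum => D.
  rewrite fpowersetE => DC; case: asboolP => [badD|_]; last first.
    by rewrite mulr_ge0 ?powR_ge0.
  apply: (weight_bad_extension gamma_gt0 gamma_alpha gap scaleB badD) => s sD.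
  by have := fsubsetP DC _ sD; rewrite mem_pairs => /andP[].
rewrite big_const_seq count_predT iter_addr_0 -[leLHS]mulr_natl /b -[leRHS]mulrA.
rewrite ler_wpM2r ?mulr_ge0 ?powR_ge0// ler_nat card_fpowerset leq_exp2l//.
apply: (leq_trans (card_pairs _)); rewrite leq_exp2l//.
apply: leq_trans (_ : #|` Z| + #|` C| <= _)%N; last by rewrite leq_add2l.
by rewrite -cardfsUI leq_addr.
Qed.

(** The first summand bounds the number of extra edges; in the second, the number of edge sets for
    one [C] is multiplied by a bound for the sum of vertex weights over all [C]. *)
Definition first_moment_const (z : nat) : K :=
  (2 ^ z)%N%:R + (2 ^ 2 ^ (z + t))%N%:R * expR ((1 - 2 * y)^-1).

Lemma sum_bad_list M : \sum_(D <- bad_list M) weight alpha D <=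
  first_moment_const #|` Z| * 2 `^ (- (gamma / 2 * n%:R)).
Proof.
have y0 : 0 <= y by exact: powR_ge0.
(* 2y = 2^(-gamma/(2t)): this is where the surplus gamma/(2t) in the vertex weights is spent. *)
have y1 : 2 * y < 1.
  rewrite -[X in X * y](@powRr1 K 2)// -powRD ?implybE ?pnatr_eq0 ?orbT//.
  rewrite opprD addNKr powRN invf_lt1 ?powR_gt0//.
  have eta0 : 0 < gamma / (2 * t%:R) by rewrite divr_gt0// mulr_gt0// ltr0n.
  suff : 1 `^ (gamma / (2 * t%:R)) < 2 `^ (gamma / (2 * t%:R)) by rewrite powR1.
  by apply: gt0_ltr_powR; rewrite ?nnegrE// ltr1n.
rewrite /bad_list big_cat mulrDl/=; apply: lerD; first exact: sum_extra_edges.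
rewrite big_flatten big_map big_enum/=.
apply: (@le_trans _ _ (\sum_(C : {set 'I_M})
   (2 ^ 2 ^ (#|` Z| + t))%N%:R * 2 `^ (- (gamma / 2 * n%:R)) *
    \prod_(c in C) y ^+ scale c)).
  apply: ler_sum => C _; apply: le_trans (sum_bad_extensions _) _.
  rewrite /fset_of_set big_imfset/=; last by move=> i j _ _; exact: val_inj.
  by rewrite big_enum.
rewrite -mulr_sumr mulrAC ler_wpM2r ?powR_ge0// ler_wpM2l//.
apply: le_trans (sum_subsets_le _) _ => [c|]; first exact: exprn_ge0.
by rewrite ler_expR sum_scale_le.
Qed.

End FirstMoment.

(** If a rigid C had an edge joining C \ Z to [B], the edges of ZC leaving [Z] would form a bad
    extension entirely present in [g]. Since [U] is arbitrary, one placement serves all times. *)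
Lemma generic_of_bad_list (g : sgraph nat) (U : pred nat) :
  [disjoint A & B]%fset ->
  (forall M D, D \in bad_list M -> exists2 s, s \in D & s \notin edges g s) ->
  generic g alpha t U B A.
Proof.
move=> AB hbad C _ CBA Ct rigidC.
have CB : [disjoint C & B]%fset.
  apply/fdisjointP => c cC; apply/negP => cB; move/fdisjointP: CBA => /(_ c cC).
  by rewrite inE cB andbT negbK => cA; move/fdisjointP: AB => /(_ c cA); rewrite cB.
have noedge s c b : s \in edges g (Z `|` C)%fset -> c \in s -> c \notin Z ->
    b \in s -> b \notin B.
  move=> sE cs cZ bs; apply/negP => bB.
  (* [C] may meet [A], whereas bad extensions are required to avoid [Z]. *)
  pose C0 := (C `\` Z)%fset.
  have ZC0 : (Z `|` C0 = Z `|` C)%fset by rewrite /C0 fsetUDl fsetDv fsetD0.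
  pose D := [fset s in edges g (Z `|` C)%fset | ~~ (s `<=` Z)%fset]%fset.
  have [|s' s'D] := hbad (\max_(c <- C0) c).+1 D.
    apply/mem_bad_list; right; exists C0.
      by move=> c' c'C; rewrite ltnS (big_rem c')//= leq_maxl.
    rewrite mem_filter fpowersetE ZC0; apply/andP; split; last first.
      apply: fsubset_trans (edges_pairs g _); apply/fsubsetP => s'.
      by rewrite inE => /andP[].
    apply/asboolP; split.
    - apply/andP; split.
        rewrite cardfs_gt0; apply/fset0Pn; exists c; rewrite in_fsetD cZ/=.
        move: sE; rewrite mem_edges => /andP[/fsubsetP/(_ c cs)].
        by rewrite in_fsetU (negbTE cZ).
      apply: leq_trans Ct; rewrite /nv -/Z; apply: fsubset_leq_card.
      by rewrite fsetDUl fsetDv fset0U.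
    - by apply/fdisjointP => c'; rewrite in_fsetD => /andP[].
    - by move=> s'; rewrite inE => /andP[].
    - exists s, b; split => //; rewrite !inE sE/=.
      by apply/fsubsetPn; exists c.
    move=> I ZI IZC; have := rigidC I ZI; rewrite -/Z.
    rewrite -ZC0 => /(_ IZC); rewrite /delta /nv /ne subr_le0.
    have IC : (I `|` C = Z `|` C0)%fset.
      have /fsubsetP IZ : (I `<=` Z `|` C)%fset by rewrite -ZC0 fproper_sub.
      rewrite ZC0; apply/fsetP => x; apply/fsetUP/fsetUP => -[xI|xC].
      - exact/fsetUP/IZ.
      - by right.
      - by left; exact: (fsubsetP ZI).
      - by right.
    rewrite IC ZC0; congr (_ <= _ * (#|` _|)%:R).
    apply/fsetP => s''; rewrite !inE /=; case: (boolP (s'' `<=` Z)%fset) => // s''Z.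
      by rewrite (fsubset_trans s''Z ZI) !andbF.
    by rewrite andbT.
  have := s'D; rewrite inE /= => /andP[+ _]; rewrite mem_edges => /andP[_ s'g].
  by rewrite s'g.
(* The two edge sets coincide: an edge leaving [Z] avoids [B] by [noedge], and an edge of AC leaving
   [A] has an endpoint in C \ A, which is outside [Z] since [C] avoids [B]. *)
rewrite /ne; congr (#|` _|); apply/fsetP => s; rewrite !inE /= -/Z.
apply/andP/andP => -[sE]; have := sE; rewrite mem_edges => /andP[/fsubsetP sZC sg].
  move=> /fsubsetPn[c cs cZ]; split; last first.
    apply/fsubsetPn; exists c => //; apply: contra cZ; rewrite inE => ->//.
  rewrite mem_edges sg andbT; apply/fsubsetP => b bs.
  have := sZC _ bs; have := noedge _ _ _ sE cs cZ bs.
  by rewrite !inE => /negbTE ->; rewrite orbF.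
move=> /fsubsetPn[c cs cA]; split.
  rewrite mem_edges sg andbT; apply/fsubsetP => b /sZC.
  by rewrite !inE => /orP[] ->; rewrite ?orbT.
apply/fsubsetPn; exists c => //; rewrite inE (negbTE cA)/=.
have := sZC _ cs; rewrite inE (negbTE cA)/=; exact: (fdisjointP CB).
Qed.

Lemma no_extra_edge (g : sgraph nat) (s : {fset nat}) :
  (forall M D, D \in bad_list M -> exists2 s, s \in D & s \notin edges g s) ->
  s \in edges g Z -> ~~ (s `<=` A)%fset -> s \in S.
Proof.
move=> hbad sE sA; apply/negPn/negP => sS.
(* Extra edges belong to the list at every truncation, so 0 will do. *)
have [|s'] := hbad 0%N [fset s]%fset.
  apply/mem_bad_list; left; apply/mapP; exists s => //.
  by rewrite mem_filter sA sS (fsubsetP (edges_pairs g _) _ sE).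
by rewrite inE => /eqP ->; have := sE; rewrite mem_edges => /andP[_ ->].
Qed.

End BadList.

(** * Placements and the second moment *)

Section Placements.
Context {V : choiceType}.
Variables (F : sgraph V) (H R : {fset V}) (sigma : V -> nat) (N : nat).
Local Notation X := (H `\` R)%fset.
Local Notation v := #|` X|.
Implicit Types (f g : {ffun X -> 'I_N}).

(* The new vertices are placed in pairwise disjoint blocks of length N, above
   the positions of R, so that two placements can only meet at a common vertex. *)
Definition place f (x : V) : nat :=
  if insub x is Some x' then ((enum_rank (x' : X)).+1 * N + f x')%N else sigma x.

Lemma place_new f (x : X) : place f (val x) = ((enum_rank x).+1 * N + f x)%N.
Proof. by rewrite /place valK. Qed.

Lemma place_old f (x : V) : x \in R -> place f x = sigma x.
Proof. by move=> xR; rewrite /place insubF// inE xR. Qed.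

Hypothesis sigma_inj : {in R &, injective sigma}.
Hypothesis sigma_lt : forall x, x \in R -> (sigma x < N)%N.

Lemma place_ge f (x : V) : x \in X -> (N <= place f x)%N.
Proof. by move=> xX; rewrite (place_new f [`xX]%fset) mulSn -addnA leq_addr. Qed.

Lemma place_lt f (x : V) : x \in (R `|` H)%fset -> (place f x < v.+1 * N)%N.
Proof.
case: (boolP (x \in R)) => [xR _|xR].
  by rewrite place_old// mulSn ltn_addr// sigma_lt.
rewrite inE (negbTE xR)/= => xH; have xX : x \in X by rewrite inE xR.
rewrite (place_new f [`xX]%fset); set y := [` _]%fset.
have yv : (enum_rank y < v)%N by rewrite cardfE; exact: ltn_ord.
apply: (@leq_trans ((enum_rank y).+2 * N)); last by rewrite leq_mul2r ltnS yv orbT.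
by rewrite mulSn addnC ltn_add2r.
Qed.

(** Division by N recovers the block, hence the vertex; the remainder is the position within it. *)
Lemma place_eq f g (x y : X) : place f (val x) = place g (val y) ->
  x = y /\ f x = g x.
Proof.
rewrite !place_new => xy.
have N0 : (0 < N)%N by apply: leq_ltn_trans (ltn_ord (f x)).
have := congr1 (fun k => k %/ N)%N xy; rewrite !divnMDl// !divn_small// !addn0.
move=> -[] /ord_inj/enum_rank_inj xyE; split => //.
by move: xy; rewrite -xyE => /addnI/ord_inj.
Qed.

Lemma place_inj f g (x y : V) : x \in (R `|` H)%fset -> y \in (R `|` H)%fset ->
  place f x = place g y -> x = y.
Proof.
move=> xRH yRH; case: (boolP (x \in R)) => xR; case: (boolP (y \in R)) => yR.
- by rewrite !place_old//; exact: sigma_inj.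
- have yX : y \in X by move: yRH; rewrite !inE (negbTE yR).
  by move=> xy; have := place_ge g yX; rewrite -xy place_old// leqNgt sigma_lt.
- have xX : x \in X by move: xRH; rewrite !inE (negbTE xR).
  by move=> xy; have := place_ge f xX; rewrite xy place_old// leqNgt sigma_lt.
have yX : y \in X by move: yRH; rewrite !inE (negbTE yR).
have xX : x \in X by move: xRH; rewrite !inE (negbTE xR).
by move=> /(@place_eq f g [`xX]%fset [`yX]%fset)[/(congr1 val)].
Qed.

Definition new_edges (I : {fset V}) : {fset {fset V}} :=
  [fset s in edges F (R `|` I)%fset | ~~ (s `<=` R)%fset]%fset.

Lemma neE I : ne F I R = #|` new_edges I|. Proof. by []. Qed.

Definition placed_edges f : {fset {fset nat}} :=
  [fset (place f @` (s : {fset V}))%fset | s in new_edges H]%fset.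

Definition new_vertices f : {fset nat} := (place f @` X)%fset.

Lemma place_sub f g (s s' : {fset V}) : (s `<=` R `|` H)%fset ->
  (s' `<=` R `|` H)%fset -> (place f @` s = place g @` s')%fset -> (s `<=` s')%fset.
Proof.
move=> /fsubsetP sRH /fsubsetP s'RH ss'; apply/fsubsetP => x xs.
have : place f x \in (place g @` s')%fset by rewrite -ss' in_imfset.
move=> /imfsetP[y /= ys' xy].
by rewrite (place_inj (sRH _ xs) (s'RH _ ys') xy).
Qed.

Lemma place_fset_inj f g (s s' : {fset V}) : (s `<=` R `|` H)%fset ->
  (s' `<=` R `|` H)%fset -> (place f @` s = place g @` s')%fset -> s = s'.
Proof.
move=> sRH s'RH ss'; apply/eqP; rewrite eqEfsubset.
by rewrite (place_sub sRH s'RH ss') (place_sub s'RH sRH (esym ss')).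
Qed.

Lemma new_edges_sub I s : s \in new_edges I -> (s `<=` R `|` I)%fset.
Proof. by rewrite !inE/= mem_edges => /andP[/andP[]]. Qed.

Lemma card_placed_edges f : #|` placed_edges f| = ne F H R.
Proof.
rewrite neE card_in_imfset//= => s s' sH s'H.
by apply: place_fset_inj; exact: new_edges_sub.
Qed.

Lemma placed_edges_pairs f :
  (placed_edges f `<=` pairs (place f @` (R `|` H)))%fset.
Proof.
apply/fsubsetP => _ /imfsetP[s /= sH ->]; rewrite mem_pairs.
have sRH := new_edges_sub sH.
rewrite card_in_imfset/=; last first.
  by move=> x y xs ys; apply: place_inj; exact: (fsubsetP sRH).
apply/andP; split; last first.
  by move: sH; rewrite !inE/= => /andP[/card_edge -> _].
by apply/fsubsetP => _ /imfsetP[x /= xs ->]; rewrite in_imfset//= (fsubsetP sRH).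
Qed.

Lemma imfset_old f : (place f @` R = sigma @` R)%fset.
Proof. by apply: eq_in_imfset => // x xR; rewrite place_old. Qed.

Lemma imfset_place f :
  (place f @` (R `|` H) = sigma @` R `|` new_vertices f)%fset.
Proof.
rewrite -(imfset_old f); apply/fsetP => y; apply/imfsetP/fsetUP => [[x /= xRH ->]|].
  case: (boolP (x \in R)) => xR; [left|right]; rewrite in_imfset//=.
  by move: xRH; rewrite !inE (negbTE xR).
by move=> [] /imfsetP[x /= xE ->]; exists x => //; move: xE; rewrite !inE;
  [move=> ->|case/andP => _ ->; rewrite orbT].
Qed.

Lemma disjoint_new_vertices f : [disjoint sigma @` R & new_vertices f]%fset.
Proof.
apply/fdisjointP => _ /imfsetP[x /= xR ->]; apply/imfsetP => -[y /= yX].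
by move=> xy; have := place_ge f yX; rewrite -xy leqNgt sigma_lt.
Qed.

Definition agreement f g : {set X} := [set x | f x == g x].

Definition fset_of (J : {set X}) : {fset V} := [fset val x | x in J]%fset.

Lemma fset_of_sub J : (fset_of J `<=` X)%fset.
Proof. by apply/fsubsetP => _ /imfsetP[x _ ->]; exact: valP. Qed.

Lemma card_fset_of J : #|` fset_of J| = #|J|.
Proof.
rewrite card_imfset/=; last exact: val_inj.
by rewrite cardE.
Qed.

(** A common edge is the image of one and the same edge of F under [f] and [g], so both placements
    agree at each of its new vertices. *)
Lemma placed_edgesI f g :
  (#|` placed_edges f `&` placed_edges g|%fset <= ne F (fset_of (agreement f g)) R)%N.
Proof.
pose I := fset_of (agreement f g).
apply: (@leq_trans #|` [fset (place f @` (s : {fset V}))%fset | s in new_edges I]%fset|);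
  last exact: leq_imfset_card.
apply: fsubset_leq_card; apply/fsubsetP => _ /fsetIP[/imfsetP[s /= sH ->]].
move=> /imfsetP[s' /= s'H ss'].
have sRH := new_edges_sub sH; have s'RH := new_edges_sub s'H.
have s'E := place_fset_inj sRH s'RH ss'; rewrite -{s' s'H s'RH}s'E in ss'.
apply: in_imfset; rewrite !inE/=; move: (sH); rewrite !inE/= => /andP[sG ->].
have sF : s \in edges F s by move: sG; rewrite mem_edges => /andP[].
rewrite andbT mem_edges sF andbT.
apply/fsubsetP => x xs; rewrite in_fsetU; case: (boolP (x \in R)) => //= xR.
have xX : x \in X by have := fsubsetP sRH _ xs; rewrite !inE (negbTE xR).
have : place f x \in (place g @` s)%fset by rewrite -ss' in_imfset.
move=> /imfsetP[y /= ys xy].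
have yx := place_inj (fsubsetP sRH _ xs) (fsubsetP sRH _ ys) xy.
rewrite -{y ys}yx in xy; have [_ fg] := @place_eq f g [`xX]%fset [`xX]%fset xy.
by apply/imfsetP; exists [`xX]%fset => //=; rewrite inE fg.
Qed.

Lemma placed_edges_disjoint f g : agreement f g = finset.set0 ->
  [disjoint placed_edges f & placed_edges g]%fset.
Proof.
move=> fg0; rewrite -fsetI_eq0 -cardfs_eq0 -leqn0 (leq_trans (placed_edgesI f g))//.
rewrite fg0 neE leqn0 cardfs_eq0; apply/eqP/fsetP => s; rewrite [RHS]inE.
apply/negbTE/negP => sE; have := new_edges_sub sE.
have -> : fset_of finset.set0 = fset0.
  by apply/fsetP => x; rewrite [RHS]inE; apply/imfsetP => -[y]; rewrite /= inE.
by rewrite fsetU0; move: sE; rewrite !inE/= => /andP[_ /negbTE ->].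
Qed.

Lemma ne_fset_of J : (ne F (fset_of J) R <= ne F H R)%N.
Proof.
rewrite !neE; apply: fsubset_leq_card; apply/fsubsetP => s; rewrite !inE/=.
move=> /andP[+ ->]; rewrite andbT => sE.
have /andP[sJ sF] : (s `<=` R `|` fset_of J)%fset && (s \in edges F s).
  by rewrite -mem_edges.
rewrite mem_edges sF andbT; apply: fsubset_trans sJ _; apply: fsetUS; apply: fsubset_trans (fset_of_sub J) _.
exact: fsubsetDl.
Qed.

(** Every placed edge contains a new vertex. The window has bounded ratio, so all placed edges have
    comparable probabilities. *)
Lemma top_placed f s : s \in placed_edges f -> (N <= top s)%N /\ (top s < v.+1 * N)%N.
Proof.
move=> /imfsetP[e /= eH ->]; have /fsubsetP eRH := new_edges_sub eH.
move: eH; rewrite !inE/= => /andP[_ /fsubsetPn[x xe xR]].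
have xX : x \in X by have := eRH _ xe; rewrite !inE (negbTE xR).
split.
  by apply: leq_trans (place_ge f xX) (leq_top _); rewrite in_imfset.
have vN0 : (0 < v.+1 * N)%N by apply: leq_ltn_trans (place_lt f (eRH _ xe)).
rewrite -(prednK vN0) ltnS; apply: top_leq => _ /imfsetP[y /= ye ->].
by rewrite -ltnS prednK// place_lt// eRH.
Qed.

End Placements.

(** * Second moment of the number of realized placements *)

Lemma powRN_anti (K : realType) (alpha x y : K) : 0 <= alpha -> 0 < x -> x <= y ->
  y `^ (- alpha) <= x `^ (- alpha).
Proof.
move=> a0 x0 xy; have y0 := lt_le_trans x0 xy.
rewrite !powRN lef_pV2 ?posrE ?powR_gt0//.
by apply: ge0_ler_powR; rewrite ?nnegrE// ltW.
Qed.

Lemma weight_le (K : realType) (alpha c : K) (D : {fset {fset nat}}) :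
  (forall s, s \in D -> edge_prob alpha s <= c) -> weight alpha D <= c ^+ #|` D|.
Proof.
move=> Dc; rewrite -iter_mulr_1 -(count_predT D) -big_const_seq /weight big_seq [leRHS]big_seq.
by apply: ler_prod => s sD; rewrite edge_prob_ge0 Dc.
Qed.

Lemma weight_ge (K : realType) (alpha c : K) (D : {fset {fset nat}}) : 0 <= c ->
  (forall s, s \in D -> c <= edge_prob alpha s) -> c ^+ #|` D| <= weight alpha D.
Proof.
move=> c0 Dc; rewrite -iter_mulr_1 -(count_predT D) -big_const_seq /weight big_seq [leRHS]big_seq.
by apply: ler_prod => s sD; rewrite c0 Dc.
Qed.

Section SecondMoment.
Context {K : realType} {V : choiceType}.
Variables (alpha gamma : K) (F : sgraph V) (H R : {fset V}) (sigma : V -> nat).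
Variables (n : nat).
Local Notation N := (2 ^ n)%N.
Local Notation X := (H `\` R)%fset.
Local Notation v := #|` X|.
Hypotheses (alpha_gt0 : 0 < alpha) (gamma_gt0 : 0 < gamma).
Hypothesis gap : forall u e : nat, (0 < u <= v)%N ->
  gamma <= `|u%:R - alpha * e%:R|.
Hypothesis HR_safe : safe F alpha H R.
Hypothesis sigma_inj : {in R &, injective sigma}.
Hypothesis sigma_lt : forall x, x \in R -> (sigma x < N)%N.
Implicit Types (f g : {ffun X -> 'I_N}).

Let S f := placed_edges F sigma f.
Let e := ne F H R.
(** This is N^(-alpha); placed edges have probability between [kappa * p] and [p]. *)
Let p : K := 2 `^ (- (alpha * n%:R)).
Let kappa : K := v.+1%:R `^ (- alpha).
Let mu : K := \sum_(f : {ffun X -> 'I_N}) weight alpha (S f).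

Lemma p_le1 : p <= 1.
Proof.
rewrite /p -[leRHS](powRr0 2); apply: ler_powR; rewrite ?ler1n//.
by rewrite oppr_le0 mulr_ge0 ?(ltW alpha_gt0).
Qed.

Lemma powR_blocks : N%:R `^ (- alpha) = p.
Proof. by rewrite natrX -powR_mulrn// -powRrM mulrN mulrC. Qed.

Lemma edge_prob_placed f s : s \in S f -> kappa * p <= edge_prob alpha s <= p.
Proof.
move=> /(top_placed sigma_lt)[Ns sN]; have a0 := ltW alpha_gt0.
have N0 : 0 < N%:R :> K by rewrite ltr0n expn_gt0.
rewrite -powR_blocks -powRM// -natrM /edge_prob; apply/andP; split.
  by apply: powRN_anti; rewrite ?ltr0n ?ler_nat.
by apply: powRN_anti; rewrite ?ler_nat// (leq_trans Ns).
Qed.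

Lemma weight_placed_ge f : (kappa * p) ^+ e <= weight alpha (S f).
Proof.
rewrite /e -(card_placed_edges F sigma_inj sigma_lt f); apply: weight_ge.
  by rewrite mulr_ge0// powR_ge0.
by move=> s /edge_prob_placed/andP[].
Qed.

Lemma first_moment_ge : (N ^ v)%N%:R * (kappa * p) ^+ e <= mu.
Proof.
apply: (@le_trans _ _ (\sum_(f : {ffun X -> 'I_N}) (kappa * p) ^+ e)).
  by rewrite sumr_const card_ffun card_ord -cardfE -[leRHS]mulr_natl.
by apply: ler_sum => f _; exact: weight_placed_ge.
Qed.

(** The indicator that [f] and [g] agree on [J], written as a product over all coordinates so that
    its sum over [g] factorizes. *)
Let agree (J : {set X}) f g : K :=
  \prod_x (if x \in J then (f x == g x)%:R else 1).

Lemma agree_agreement f g : agree (agreement f g) f g = 1.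
Proof. by rewrite /agree big1// => x _; rewrite inE; case: eqP. Qed.

Lemma agree_ge0 J f g : 0 <= agree J f g.
Proof. by apply: prodr_ge0 => x _; case: ifP. Qed.

Let eJ (J : {set X}) := ne F (fset_of J) R.

(** Without agreement the edge sets are disjoint and the weight factors. Otherwise the term of the
    exact agreement set suffices: the union has at least 2e - eJ edges, each of probability at most
    p. *)
Lemma weight_placedU f g : weight alpha (S f `|` S g)%fset <=
  weight alpha (S f) * weight alpha (S g) +
  \sum_(J : {set X} | J != finset.set0) agree J f g * p ^+ (2 * e - eJ J).
Proof.
have rest0 (P : pred {set X}) : 0 <= \sum_(J | P J) agree J f g * p ^+ (2 * e - eJ J).
  by apply: sumr_ge0 => J _; rewrite mulr_ge0 ?agree_ge0// exprn_ge0// powR_ge0.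
have [fg0|fg0] := eqVneq (agreement f g) finset.set0.
  rewrite weightU ?lerDl//; exact: placed_edges_disjoint.
rewrite (bigD1 (agreement f g))//= agree_agreement mul1r.
apply: (@le_trans _ _ (p ^+ (2 * e - eJ (agreement f g)))); last first.
  by rewrite addrCA lerDl; apply: addr_ge0 (rest0 _); rewrite mulr_ge0 ?weight_ge0.
apply: (@le_trans _ _ (p ^+ #|` S f `|` S g|%fset)).
  by apply: weight_le => s; rewrite inE => /orP[] /edge_prob_placed/andP[].
apply: ler_wiXn2l; rewrite ?powR_ge0 ?p_le1//.
rewrite cardfsU !(card_placed_edges F sigma_inj sigma_lt) -/e addnn -mul2n.
apply: leq_sub2l; exact: placed_edgesI.
Qed.

Lemma sum_agree (J : {set X}) :
  \sum_f \sum_g agree J f g = (N ^ v)%N%:R * (N ^ (v - #|J|))%N%:R.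
Proof.
have inner f : \sum_g agree J f g = (N ^ (v - #|J|))%N%:R.
  rewrite /agree -(bigA_distr_bigA (fun x j => if x \in J then (f x == j)%:R else 1)).
  rewrite (bigID (mem J))/= big1 ?mul1r; last first.
    move=> x xJ; rewrite xJ (bigD1 (f x))//= eqxx big1 ?addr0// => j.
    by rewrite eq_sym => /negbTE ->.
  rewrite (eq_bigr (fun=> N%:R)); last first.
    by move=> x /negbTE ->; rewrite sumr_const card_ord.
  rewrite prodr_const -natrX; congr (_ ^ _)%:R.
  by rewrite cardfE -[in RHS](cardC (mem J)) addKn; apply: eq_card => x.
rewrite (eq_bigr _ (fun f _ => inner f)) sumr_const card_ffun card_ord -cardfE.
by rewrite -[LHS]mulr_natl.
Qed.

(** Safety gives delta(J/R) >= 0, and the gap raises this to delta(J/R) >= gamma. *)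
Lemma safe_agreement (J : {set X}) : J != finset.set0 ->
  alpha * (eJ J)%:R + gamma <= #|J|%:R.
Proof.
move=> J0; have Jv : (0 < #|J| <= v)%N by rewrite card_gt0 J0 cardfE max_card.
have := gap (eJ J) Jv.
have JX := fset_of_sub J.
have RRJ : (R `|` (R `|` fset_of J) = R `|` fset_of J)%fset by rewrite fsetUA fsetUid.
have := HR_safe (fsubsetUl R (fset_of J)).
have -> : (R `|` fset_of J `<=` R `|` H)%fset.
  by apply: fsetUS; apply: fsubset_trans JX (fsubsetDl _ _).
move=> /(_ isT); rewrite /delta {1}/nv /ne RRJ -/(ne F (fset_of J) R).
have -> : ((R `|` fset_of J) `\` R)%fset = fset_of J.
  rewrite fsetDUl fsetDv fset0U; apply/fsetDidPl.
  by apply/fdisjointP => x /(fsubsetP JX); rewrite inE => /andP[].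
rewrite card_fset_of -/(eJ J) => d0; rewrite ger0_norm//; lra.
Qed.

(** In powers of N, the left side is (N^v p^e)^2 times N^(-delta(J/R)). *)
Lemma agreement_term (J : {set X}) : J != finset.set0 ->
  (N ^ v)%N%:R * (N ^ (v - #|J|))%N%:R * p ^+ (2 * e - eJ J) <=
  2 `^ (- (gamma * n%:R)) * ((N ^ v)%N%:R * p ^+ e) ^+ 2.
Proof.
move=> J0; have := safe_agreement J0.
have Jv : (#|J| <= v)%N by rewrite cardfE max_card.
have eJe : (eJ J <= 2 * e)%N.
  by apply: leq_trans (ne_fset_of F J) _; rewrite mul2n -addnn leq_addr.
have NE k : (N ^ k)%N%:R = 2 `^ (n%:R * k%:R) :> K.
  by rewrite !natrX powRrM !powR_mulrn// powR_ge0.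
have pE k : p ^+ k = 2 `^ (- (alpha * n%:R) * k%:R) by rewrite powRrM powR_mulrn// powR_ge0.
have D2 x y : 2 `^ x * 2 `^ y = 2 `^ (x + y) :> K.
  by rewrite powRD// implybE pnatr_eq0 orbT.
rewrite !NE !pE expr2 !D2 !natrB// natrM => h; apply: ler_powR; rewrite ?ler1n//.
have : 0 <= n%:R * (#|J|%:R - (alpha * (eJ J)%:R + gamma)).
  by rewrite mulr_ge0// subr_ge0.
rewrite -[(2%N)%:R]/(2 : K); nra.
Qed.

Lemma second_moment : \sum_f \sum_g weight alpha (S f `|` S g)%fset <=
  (1 + (2 ^ v)%N%:R * kappa ^- (2 * e) * 2 `^ (- (gamma * n%:R))) * mu ^+ 2.
Proof.
apply: (@le_trans _ _ (\sum_f \sum_g (weight alpha (S f) * weight alpha (S g) +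
  \sum_(J : {set X} | J != finset.set0) agree J f g * p ^+ (2 * e - eJ J)))).
  by do 2![apply: ler_sum => ? _]; exact: weight_placedU.
under eq_bigr do rewrite big_split/=.
rewrite big_split/= mulrDl mul1r; apply: lerD.
  rewrite expr2 {1}/mu mulr_suml; apply: ler_sum => f _.
  by rewrite mulr_sumr.
under eq_bigr do rewrite exchange_big/=.
rewrite exchange_big/=.
(* [M] is the mean with every edge probability replaced by p; it exceeds [mu] at most by the factor
   kappa^(-e). *)
pose M := (N ^ v)%N%:R * p ^+ e.
apply: (@le_trans _ _ (\sum_(J : {set X} | J != finset.set0) 2 `^ (- (gamma * n%:R)) * M ^+ 2)).
  apply: ler_sum => J J0.
  have -> : \sum_f \sum_g agree J f g * p ^+ (2 * e - eJ J) =
    (N ^ v)%N%:R * (N ^ (v - #|J|))%N%:R * p ^+ (2 * e - eJ J).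
    rewrite -sum_agree mulr_suml; apply: eq_bigr => f _.
    by rewrite mulr_suml.
  exact: agreement_term.
have kappa0 : 0 < kappa by rewrite powR_gt0// ltr0n.
have Mmu : M ^+ 2 <= kappa ^- (2 * e) * mu ^+ 2.
  rewrite mulrC ler_pdivlMr ?exprn_gt0// mulnC exprM -exprMn.
  have M0 : 0 <= M by rewrite mulr_ge0// exprn_ge0// powR_ge0.
  rewrite lerXn2r// ?nnegrE; first by rewrite mulr_ge0// exprn_ge0// ltW.
  - by apply: sumr_ge0 => f _; exact: weight_ge0.
  - by apply: le_trans first_moment_ge; rewrite exprMn /M mulrAC mulrA.
rewrite sumr_const -[leLHS]mulr_natl -[leRHS]mulrA -[leRHS]mulrA ler_pM//.
- by rewrite mulr_ge0 ?powR_ge0// sqr_ge0.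
- rewrite ler_nat; apply: leq_trans (max_card _) _.
  by rewrite -cardsT -powersetT card_powerset cardsT -cardfE.
by rewrite [leRHS]mulrCA; apply: ler_wpM2l; rewrite ?powR_ge0.
Qed.

End SecondMoment.

(** * Almost sure existence *)

Section Thinning.
Import numFieldNormedType.Exports.
Context {d : measure_display} {Omega : measurableType d} {K : realType}.
Variables (P : probability Omega K) (alpha gamma : K) (G : Omega -> sgraph nat).
Hypothesis G_process : shelah_spencer P alpha G.
Context {V : choiceType}.
Variables (F : sgraph V) (H R : {fset V}) (t : nat) (sigma : V -> nat).
Local Notation X := (H `\` R)%fset.
Local Notation v := #|` X|.
Hypotheses (t_gt0 : (0 < t)%N) (gamma_gt0 : 0 < gamma) (gamma_alpha : gamma <= alpha).
Hypothesis gap : forall u e : nat, (0 < u <= maxn t v)%N ->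
  gamma <= `|u%:R - alpha * e%:R|.
Hypothesis HR_safe : safe F alpha H R.
Hypothesis sigma_inj : {in R &, injective sigma}.

Definition bad_structures (N : nat) (f : {ffun X -> 'I_N}) :
    nat -> seq {fset {fset nat}} :=
  bad_list alpha t (sigma @` R)%fset (new_vertices sigma f) (placed_edges F sigma f).

(** The case that no placement is realized is included. The event grows with [M]. *)
Definition all_bad (n M : nat) : set Omega :=
  [set w | forall f : {ffun X -> 'I_(2 ^ n)},
    cylinder G (placed_edges F sigma f) w ->
    exists2 D, D \in bad_structures f M & cylinder G D w]%classic.

Lemma measurable_all_bad n M : measurable (all_bad n M).
Proof.
have -> : all_bad n M = (\bigcap_(f in [set: {ffun X -> 'I_(2 ^ n)}])
   (~` cylinder G (placed_edges F sigma f) `|`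
    \bigcup_(D in [set` bad_structures f M]) cylinder G D))%classic.
  apply/seteqP; split => w /= hw f.
    move=> _; have [Sf|nSf] := pselect (cylinder G (placed_edges F sigma f) w).
      by right; have [D DB Dw] := hw f Sf; exists D.
    by left.
  by move=> Sf; case: (hw f I) => // -[D DB Dw]; exists D.
apply: fin_bigcap_measurable => [|f _]; first exact: finite_finset.
apply: measurableU; first exact/measurableC/(measurable_cylinder G_process).
apply: fin_bigcup_measurable => [|D _]; first exact: finite_seq.
exact: (measurable_cylinder G_process).
Qed.

Lemma all_bad_mono n : {homo all_bad n : M M' / (M <= M')%N >-> (M <= M')%O}.
Proof.
move=> M M' MM'; apply/subsetPset => w hw f Sf; have [D DB Dw] := hw f Sf.
by exists D => //; exact: bad_list_mono DB.
Qed.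

Definition thinning_const : K :=
  (2 ^ v)%N%:R * v.+1%:R `^ (- alpha) ^- (2 * ne F H R) +
  2 * first_moment_const t gamma #|` R `|` H|%fset.

Lemma leq_scale_new n (f : {ffun X -> 'I_(2 ^ n)}) b :
  b \in new_vertices sigma f -> (n <= scale b)%N.
Proof.
move=> /imfsetP[x /= xX ->]; rewrite -{1}(@trunc_expnK 2 n)//.
by apply: leq_trunc_log; apply: leqW; exact: place_ge.
Qed.

Lemma placed_disjoint n (f : {ffun X -> 'I_(2 ^ n)}) M D :
  (forall x, x \in R -> (sigma x < 2 ^ n)%N) -> D \in bad_structures f M ->
  [disjoint placed_edges F sigma f & D]%fset.
Proof.
move=> sigma_lt; apply: bad_list_disjoint; rewrite -imfset_place//.
exact: placed_edges_pairs.
Qed.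

(** The sieve is divided by mu^2: [second_moment] controls the excess over mu^2, and independence of
    a placement from its bad structures bounds the spoiled pairs by mu times [sum_bad_list]. *)
Lemma probability_all_bad n M : (forall x, x \in R -> (sigma x < 2 ^ n)%N) ->
  fine (P (all_bad n M)) <= thinning_const * 2 `^ (- (gamma / 2 * n%:R)).
Proof.
move=> sigma_lt; have alpha_gt0 : 0 < alpha by exact: lt_le_trans gamma_alpha.
pose S (f : {ffun X -> 'I_(2 ^ n)}) := placed_edges F sigma f.
have S2 f s : s \in S f -> #|` s| = 2.
  by move=> /(fsubsetP (placed_edges_pairs F sigma_inj sigma_lt f)); rewrite mem_pairs => /andP[_ /eqP].
have := second_moment_sieve P (E := fun f => cylinder G (S f)) (B := cylinder G)
  (r := fun f => bad_structures f M) (fun f => measurable_cylinder G_process (S f))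
  (measurable_cylinder G_process) (measurable_all_bad n M).
cbv zeta => /(_ _)/wrap[|]; first by move=> w f hw; exact: hw.
have muE : \sum_f fine (P (cylinder G (S f))) = \sum_f weight alpha (S f).
  apply: eq_bigr => f _; rewrite (probability_cylinder G_process)//; exact: S2.
rewrite muE; set mu := \sum_f weight alpha (S f).
have -> : \sum_f \sum_g fine (P (cylinder G (S f) `&` cylinder G (S g))%classic) =
   \sum_f \sum_g weight alpha (S f `|` S g)%fset.
  apply: eq_bigr => f _; apply: eq_bigr => g _.
  rewrite -cylinderU (probability_cylinder G_process)// => s.
  by rewrite inE => /orP[] /S2.
have le_Y : \sum_f \sum_(D <- bad_structures f M)
    fine (P (cylinder G (S f) `&` cylinder G D)%classic) <=
   mu * (first_moment_const t gamma #|` R `|` H|%fset * 2 `^ (- (gamma / 2 * n%:R))).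
  rewrite /mu mulr_suml; apply: ler_sum => f _.
  apply: (@le_trans _ _ (weight alpha (S f) *
     \sum_(D <- bad_structures f M) weight alpha D)).
    rewrite mulr_sumr big_seq [leRHS]big_seq; apply: ler_sum => D DB.
    rewrite -cylinderU (probability_cylinder G_process)/=; last first.
      by move=> s; rewrite inE => /orP[/S2//|]; exact: bad_list_card2 DB.
    by rewrite weightU//; exact: placed_disjoint DB.
  rewrite ler_wpM2l ?weight_ge0//.
  have -> : #|` R `|` H|%fset = #|` sigma @` R `|` new_vertices sigma f|%fset.
    rewrite -imfset_place//; apply/esym/eqP/card_in_imfsetP => x y xRH yRH.
    exact: (place_inj sigma_inj sigma_lt).
  apply: sum_bad_list => // [u e /andP[u0 ut]|b]; last exact: leq_scale_new.
  by apply: gap; rewrite u0 leq_max ut.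
have gap_v (u e : nat) : (0 < u <= v)%N -> gamma <= `|u%:R - alpha * e%:R|.
  by move=> /andP[u0 uv]; apply: gap; rewrite u0 leq_max uv orbT.
have mu_gt0 : 0 < mu.
  by apply: lt_le_trans (first_moment_ge F H alpha_gt0 sigma_inj sigma_lt).
have := second_moment alpha_gt0 gap_v HR_safe sigma_inj sigma_lt.
rewrite -/S -/mu; set XX := \sum_f \sum_g _; set c1 := _ * _ ^- _.
set q1 := 2 `^ (- (gamma * n%:R)); set q2 := 2 `^ (- (gamma / 2 * n%:R)).
move=> le_XX sieve.
have q12 : q1 <= q2.
  apply: ler_powR; rewrite ?ler1n// lerN2 ler_wpM2r//; move: gamma_gt0; lra.
have c1_ge0 : 0 <= c1 by rewrite mulr_ge0// invr_ge0 exprn_ge0// powR_ge0.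
rewrite /thinning_const -/c1.
move: le_Y; set c2 := first_moment_const _ _ _; set Y := \sum_f \sum_(D <- _) _ => le_Y.
rewrite -(ler_pM2l (exprn_gt0 2 mu_gt0)).
have : 2 * mu * Y <= 2 * mu * (mu * (c2 * q2)) by rewrite ler_wpM2l ?mulr_ge0 ?(ltW mu_gt0).
have : c1 * q1 * mu ^+ 2 <= c1 * q2 * mu ^+ 2.
  by rewrite ler_wpM2r ?sqr_ge0// ler_wpM2l.
move: sieve; rewrite -/Y => sieve; move: sieve le_XX; lra.
Qed.

Lemma good_placement n (f : {ffun X -> 'I_(2 ^ n)}) (w : Omega) :
    (forall x, x \in R -> (sigma x < 2 ^ n)%N) ->
    cylinder G (placed_edges F sigma f) w ->
    (forall M D, D \in bad_structures f M -> ~ cylinder G D w) ->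
  forall tau, time_ge (v.+1 * 2 ^ n) tau -> exists H' : {fset nat},
    [/\ {subset (sigma @` R `|` H')%fset <= nodes tau},
        is_copy F (G w) H R H' (sigma @` R)%fset &
        generic (G w) alpha t (nodes tau) H' (sigma @` R)%fset].
Proof.
move=> sigma_lt Sw notbad tau tau_ge; exists (new_vertices sigma f).
have hbad M D : D \in bad_structures f M ->
    exists2 s, s \in D & s \notin edges (G w) s.
  move=> /notbad nD; apply: contrapT => h; apply: nD => s sD.
  by apply/negPn/negP => sG; apply: h; exists s.
split.
- rewrite -imfset_place// => _ /imfsetP[x /= xRH ->].
  have := place_lt sigma_lt f xRH; rewrite /nodes unfold_in.
  by case: tau tau_ge => //= m + h; exact: leq_trans.
- exists (place sigma f); split.
  + by move=> x y xRH yRH; exact: (place_inj sigma_inj sigma_lt).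
  + exact: imfset_place.
  + exact: imfset_old.
  move=> x y xRH yRH xyR.
  have xyH : ([fset x; y] `<=` R `|` H)%fset.
    by apply/fsubsetP => z /fset2P[] ->.
  have im2 : (place sigma f @` [fset x; y])%fset =
      [fset place sigma f x; place sigma f y]%fset.
    by rewrite imfsetU !imfset_fset1.
  apply/idP/idP => [Fxy|Gxy].
    have : (place sigma f @` [fset x; y])%fset \in placed_edges F sigma f.
      apply/imfsetP; exists [fset x; y]%fset => //=.
      rewrite !inE/= mem_edges2 xRH yRH Fxy/=.
      by apply: contra xyR => /fsubsetP h; rewrite !h ?inE ?eqxx ?orbT.
    by move=> /Sw; rewrite im2 mem_edges2 => /and3P[].
  (* Adjacency is reflected because no extra edge is present; injectivity of the placement then
     leads back to an edge of F. *)
  have : [fset place sigma f x; place sigma f y]%fset \in placed_edges F sigma f.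
    apply: (no_extra_edge hbad); rewrite -?imfset_place//.
      by rewrite mem_edges2; apply/and3P; split => //; exact: in_imfset.
    apply: contra xyR => /fsubsetP h.
    have inR z : z \in [fset x; y]%fset -> z \in R.
      move=> zxy; have : place sigma f z \in (sigma @` R)%fset.
        by apply: h; rewrite -im2 in_imfset.
      rewrite -(imfset_old sigma f) => /imfsetP[r /= rR zr].
      rewrite (place_inj sigma_inj sigma_lt (fsubsetP xyH _ zxy) _ zr)//.
      by rewrite inE rR.
    by rewrite !inR ?inE ?eqxx ?orbT.
  rewrite -im2 => /imfsetP[e /= eH xye].
  have := place_fset_inj sigma_inj sigma_lt xyH (new_edges_sub eH) xye.
  by move=> xyE; move: eH; rewrite -xyE !inE/= mem_edges2 => /andP[/and3P[]].
by apply: generic_of_bad_list hbad; exact: disjoint_new_vertices.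
Qed.

(** There are finitely many placements: if each were spoiled at its own truncation, all would be at
    the largest one. *)
Lemma all_badP n (w : Omega) :
    (forall M, ~ all_bad n M w) ->
  exists2 f : {ffun X -> 'I_(2 ^ n)}, cylinder G (placed_edges F sigma f) w &
    forall M D, D \in bad_structures f M -> ~ cylinder G D w.
Proof.
move=> nbad; apply: contrapT => nf.
have bad f : exists M, cylinder G (placed_edges F sigma f) w ->
    exists2 D, D \in bad_structures (f : {ffun X -> 'I_(2 ^ n)}) M & cylinder G D w.
  apply: contrapT => h; apply: nf; exists f.
    by apply: contrapT => nSf; apply: h; exists 0%N => /nSf.
  by move=> M D DB Dw; apply: h; exists M => _; exists D.
have [Mf MfP] := choice bad.
apply: (nbad (\max_f Mf f)) => f /MfP[D DB Dw]; exists D => //.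
by apply: bad_list_mono DB; exact: leq_bigmax.
Qed.

Lemma ae_good_placement : {ae P, forall w, exists n0 : nat, forall tau : time,
  time_ge n0 tau -> exists H' : {fset nat},
    [/\ {subset (sigma @` R `|` H')%fset <= nodes tau},
        is_copy F (G w) H R H' (sigma @` R)%fset &
        generic (G w) alpha t (nodes tau) H' (sigma @` R)%fset]}.
Proof.
pose n1 := (\max_(x <- R) sigma x).+1.
(* sigma x < n1 <= n < 2^n. *)
have sigma_lt n : (n1 <= n)%N -> forall x, x \in R -> (sigma x < 2 ^ n)%N.
  move=> n1n x xR; apply: leq_trans (ltnW (ltn_expl n (isT : 1 < 2)%N)).
  by apply: leq_trans n1n; rewrite ltnS (big_rem x)//= leq_maxl.
pose U n := (\bigcup_M all_bad n M)%classic.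
have mU n : measurable (U n).
  by apply: bigcupT_measurable => M; exact: measurable_all_bad.
have PU n : (n1 <= n)%N ->
    fine (P (U n)) <= thinning_const * 2 `^ (- (gamma / 2 * n%:R)).
  move=> n1n; rewrite -lee_fin fineK ?fin_num_measure//.
  (* Continuity from below carries the bound, uniform in M, to all finite extensions in nat at
     once. *)
  have cvg := nondecreasing_cvg_mu (mu := P) (measurable_all_bad n) (mU n) (@all_bad_mono n).
  rewrite -(cvg_lim _ cvg)//; apply: lime_le.
    by apply/cvg_ex; eexists; exact: cvg.
  apply: nearW => M /=; rewrite -[leLHS]fineK ?fin_num_measure//; last exact: measurable_all_bad.
  by rewrite lee_fin; exact: probability_all_bad (sigma_lt _ n1n).
(* One good scale suffices, so failure means failure at every scale, and P(W) <= P(U n) tends to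
   0. *)
pose W := (\bigcap_n U (n1 + n))%classic.
have mW : measurable W by exact: bigcapT_measurable.
exists W; split => //; last first.
  move=> w /= nw n _; apply: contrapT => nU; apply: nw.
  have [|f Sf nbad] := @all_badP (n1 + n) w.
    by move=> M bM; apply: nU; exists M.
  exists (v.+1 * 2 ^ (n1 + n))%N.
  exact: good_placement (sigma_lt _ (leq_addr _ _)) Sf nbad.
pose q : K := 2 `^ (- (gamma / 2)).
have q_ge0 : 0 <= q by exact: powR_ge0.
have q_lt1 : q < 1.
  rewrite /q powRN invf_lt1 ?powR_gt0//.
  suff : 1 `^ (gamma / 2) < 2 `^ (gamma / 2) by rewrite powR1.
  by apply: gt0_ltr_powR; rewrite ?nnegrE// ?ltr1n// divr_gt0.
have PW n : fine (P W) <= thinning_const * q ^+ n1 * q ^+ n.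
  apply: (@le_trans _ _ (fine (P (U (n1 + n)%N)))).
    apply: fine_le; rewrite ?fin_num_measure//.
    by apply: le_measure; rewrite ?inE// => w; apply.
  apply: le_trans (PU _ (leq_addr _ _)) _.
  by rewrite -[leRHS]mulrA -exprD -powR_mulrn// -powRrM mulNr.
have PW0 : fine (P W) <= 0.
  have qn : (thinning_const * q ^+ n1 * q ^+ n @[n --> \oo] --> (0 : K))%classic.
    have q_norm : `|q| < 1 by rewrite ger0_norm.
    by have := cvgM (cvg_cst (thinning_const * q ^+ n1)) (cvg_expr q_norm); rewrite mulr0; apply.
  by apply: (cvgr_to_ge qn); exact: nearW.
apply/eqP; rewrite -[X in X == _]fineK ?fin_num_measure// eqe.
by rewrite eq_le PW0/= fine_ge0// measure_ge0.
Qed.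

End Thinning.

Lemma exists_bijection (V : choiceType) (R : {fset V}) (R' : {fset nat}) :
  #|` R'| = #|` R| -> exists2 sigma : V -> nat,
    {in R &, injective sigma} & (sigma @` R = R')%fset.
Proof.
move=> RR'; pose sigma x := nth 0%N R' (index x R).
have sigma_inj : {in R &, injective sigma}.
  move=> x y xR yR /eqP; rewrite nth_uniq ?fset_uniq ?RR' ?index_mem// => /eqP.
  exact: index_inj.
exists sigma => //; apply/eqP; rewrite eqEfcard card_in_imfset//= RR' leqnn andbT.
apply/fsubsetP => _ /imfsetP[x /= xR ->].
by rewrite mem_nth// RR' index_mem.
Qed.

Theorem mainTheorem2 (d : measure_display) (Omega : measurableType d)
    (K : realType) (P : probability Omega K)
    (alpha : K) (alpha_gt0 : 0 < alpha) (alpha_lt1 : alpha < 1)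
    (alpha_irrational : irrational alpha)
    (G : Omega -> sgraph nat) (G_process : shelah_spencer P alpha G)
    (V : choiceType) (F : sgraph V) (H R : {fset V})
    (HR_safe : safe F alpha H R) (t : nat) (t_ge1 : (1 <= t)%N) :
  {ae P, forall w : Omega,
    forall R' : {fset nat}, #|` R'|%fset = #|` R|%fset ->
      exists n0 : nat, forall tau : time, time_ge n0 tau ->
        exists H' : {fset nat},
          [/\ {subset (R' `|` H')%fset <= nodes tau},
              is_copy F (G w) H R H' R' &
              generic (G w) alpha t (nodes tau) H' R']}.
Proof.
(* The range covers both uses of the gap: rigid extensions by at most t vertices, and agreement sets
   inside H \ R. *)
have [g g_gt0 gap] := irrational_gap alpha_gt0 alpha_irrational (maxn t #|` H `\` R|%fset).
pose gamma := Num.min g alpha.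
have gamma_gt0 : 0 < gamma by rewrite lt_min g_gt0.
have gamma_alpha : gamma <= alpha by rewrite ge_min lexx orbT.
have gamma_gap u e : (0 < u <= maxn t #|` H `\` R|%fset)%N ->
    gamma <= `|u%:R - alpha * e%:R|.
  by move=> /gap h; rewrite ge_min h.
pose Q (R' : {fset nat}) (w : Omega) := #|` R'|%fset = #|` R|%fset ->
  exists n0 : nat, forall tau : time, time_ge n0 tau -> exists H' : {fset nat},
    [/\ {subset (R' `|` H')%fset <= nodes tau},
        is_copy F (G w) H R H' R' &
        generic (G w) alpha t (nodes tau) H' R'].
have aeQ R' : {ae P, forall w, Q R' w}.
  have [RR'|RR'] := pselect (#|` R'|%fset = #|` R|%fset); last first.
    by apply: aeW => w /RR'.
  have [sigma sigma_inj sigmaR] := exists_bijection RR'.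
  have := ae_good_placement G_process t_ge1 gamma_gt0 gamma_alpha gamma_gap HR_safe sigma_inj.
  by rewrite sigmaR; apply: filterS => w h _.
(* Finite sets of naturals are countable; integers that code no set carry the trivial statement. *)
have := ae_foralln (mu := P) (P := fun n w => if @choice.unpickle {fset nat} n is Some R' then Q R' w else True).
move=> /(_ _)/wrap[|].
  by move=> n; case: (choice.unpickle n) => [R'|]; [exact: aeQ|exact: aeW].
by apply: filterS => w h R'; have := h (choice.pickle R'); rewrite choice.pickleK.
Qed.
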